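(* Let $K\in\mathbb R$, $N\in(-\infty,0]\cup(1,\infty]$ and $D\in(0,\infty)$. Let $$\mathcal D^{reg}_{(K,N,D)}=\{(\mathfrak h,d)\in\mathbb R\times(0,D]:\ [-\tfrac d2,\tfrac d2]\subset U_{\mathfrak h}\},$$ and for $(\mathfrak h,d)\in\mathcal D^{reg}_{(K,N,D)}$ let $\lambda(\mathfrak h,d)=\Lambda_{Poi}\big(J_{K,N,\mathfrak h}(x)1_{[-d/2,d/2]}(x)\,dx\big)$. 1. For any fixed $\mathfrak h_0$ occurring as a first coordinate of a point of $\mathcal D^{reg}_{(K,N,D)}$, the function $d\mapsto\lambda(\mathfrak h_0,d)$ on $\{d:(\mathfrak h_0,d)\in\mathcal D^{reg}_{(K,N,D)}\}$ monotonically decreases as $d$ increases. 2. For any fixed $d_0$ occurring as a second coordinate of a point of $\mathcal D^{reg}_{(K,N,D)}$, the function $\mathfrak h\mapsto\lambda(\mathfrak h,d_0)$ on $\{\mathfrak h:(\mathfrak h,d_0)\in\mathcal D^{reg}_{(K,N,D)}\}$ (a) monotonically increases as $|\mathfrak h|$ increases if $N\in(-\infty,-1)\cup(1,\infty]$; (b) monotonically decreases as $|\mathfrak h|$ increases if $N\in(-1,0]$; (c) is independent of $\mathfrak h$ if $N=-1$.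
   Context: $\delta=\frac K{N-1}$ ($0$ if $N=\infty$). $\mathfrak s_\delta(x)=\sin(\sqrt\delta x)/\sqrt\delta$, $x$, $\sinh(\sqrt{-\delta}x)/\sqrt{-\delta}$ and $\mathfrak c_\delta(x)=\cos(\sqrt\delta x)$, $1$, $\cosh(\sqrt{-\delta}x)$ for $\delta>0,=0,<0$. For $\mathfrak h\in\mathbb R$, $U_{\mathfrak h}$ is the maximal open interval containing $0$ on which $\mathfrak c_\delta+\frac{\mathfrak h}{N-1}\mathfrak s_\delta>0$ ($U_{\mathfrak h}=\mathbb R$ if $N=\infty$); on $U_{\mathfrak h}$, $J_{K,N,\mathfrak h}(x)=(\mathfrak c_\delta(x)+\frac{\mathfrak h}{N-1}\mathfrak s_\delta(x))^{N-1}$ if $N<\infty$ and $J_{K,\infty,\mathfrak h}(x)=e^{\mathfrak hx-Kx^2/2}$. For a finite measure $\xi$ on $\mathbb R$, $\Lambda_{Poi}(\xi)=\inf\Big\{\frac{\int f'^2d\xi}{\int f^2d\xi}:0\not\equiv f\in C_c^\infty(\mathbb R),\ \int f\,d\xi=0\Big\}$, a quotient with denominator $0$ being $+\infty$. Monotonicity is understood in the weak (non-strict) sense; ''monotonically increases (decreases) as $|\mathfrak h|$ increases'' means that $|\mathfrak h_1|\le|\mathfrak h_2|$ implies $\lambda(\mathfrak h_1,d_0)\le\lambda(\mathfrak h_2,d_0)$ (respectively $\ge$). *)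

(* Defs.v *)
From HB Require Import structures.
From mathcomp Require Import all_boot all_order all_algebra.
From mathcomp Require Import all_classical all_reals all_analysis.
From mathcomp Require Import measurable_realfun.

Set Implicit Arguments.
Unset Strict Implicit.
Unset Printing Implicit Defensive.

Import Order.TTheory GRing.Theory Num.Theory.
Import numFieldNormedType.Exports.

Local Open Scope classical_set_scope.
Local Open Scope ring_scope.

Section model_density.
Context {R : realType}.
Implicit Types (K D h d t x : R) (N : \bar R).

Definition sinh x : R := (expR x - expR (- x)) / 2.
Definition cosh x : R := (expR x + expR (- x)) / 2.

Definition sfun t x : R :=
  if 0 < t then sin (Num.sqrt t * x) / Num.sqrt t
  else if t == 0 then x
  else sinh (Num.sqrt (- t) * x) / Num.sqrt (- t).

Definition cfun t x : R :=
  if 0 < t then cos (Num.sqrt t * x)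
  else if t == 0 then 1
  else cosh (Num.sqrt (- t) * x).

(* In the matches on [N] below, the last branch is meant for [N = +oo];
   [N = -oo] is never an admissible value. *)
Definition delta K N : R := if N is n%:E then K / (n - 1) else 0.

(* [c_delta + h / (N - 1) s_delta], for finite [N = n]. *)
Definition Jbase K (n : R) h x : R :=
  cfun (delta K n%:E) x + h / (n - 1) * sfun (delta K n%:E) x.

(* The union of all open intervals containing [0] on which [Jbase] is positive,
   that is, the largest such interval. *)
Definition U K N h : set R :=
  if N is n%:E then
    \bigcup_(I in [set I : set R | [/\ open I, is_interval I, I 0 &
                                     forall x, I x -> 0 < Jbase K n h x]]) I
  else setT.

(* The formula for [J] makes sense for all [x], but is only meaningful on
   [U K N h], where the base of the real power is positive. *)
Definition J K N h x : R :=
  if N is n%:E then Jbase K n h x `^ (n - 1)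
  else expR (h * x - K * x ^+ 2 / 2).

Definition Dreg K N D : set (R * R) :=
  [set p | [/\ 0 < p.2, p.2 <= D & `[- (p.2 / 2), p.2 / 2] `<=` U K N p.1]].

Lemma J_ge0 K N h x : 0 <= J K N h x.
Proof. by case: N => [n| |]; rewrite /J ?powR_ge0 ?expR_ge0. Qed.

Lemma measurable_sinh : measurable_fun setT sinh.
Proof.
apply: measurable_funM => //; apply: measurable_funB => //.
exact: measurableT_comp.
Qed.

Lemma measurable_cosh : measurable_fun setT cosh.
Proof.
apply: measurable_funM => //; apply: measurable_funD => //.
exact: measurableT_comp.
Qed.

Lemma measurable_sfun t : measurable_fun setT (sfun t).
Proof.
rewrite /sfun; case: (0 < t); last case: (t == 0) => //.
- apply: measurable_funM => //; apply: measurableT_comp => //.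
  by apply: continuous_measurable_fun; exact: continuous_sin.
- apply: measurable_funM => //; apply: measurableT_comp => //.
  exact: measurable_sinh.
Qed.

Lemma measurable_cfun t : measurable_fun setT (cfun t).
Proof.
rewrite /cfun; case: (0 < t); last case: (t == 0) => //.
- apply: measurableT_comp => //.
  by apply: continuous_measurable_fun; exact: continuous_cos.
- by apply: measurableT_comp => //; exact: measurable_cosh.
Qed.

Lemma measurable_J K N h : measurable_fun setT (J K N h).
Proof.
have mexp : measurable_fun setT (fun x : R => expR (h * x - K * x ^+ 2 / 2)).
  apply: measurableT_comp => //; apply: measurable_funB.
    by apply: measurable_funM.
  by do 2 (apply: measurable_funM => //).
case: N => [n| |] //; apply: (measurableT_comp (measurable_powR _)).
apply: measurable_funD; first exact: measurable_cfun.
by apply: measurable_funM => //; exact: measurable_sfun.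
Qed.

Definition Jcut K N h d x : R := J K N h x * \1_(`[- (d / 2), d / 2]) x.

Lemma Jcut_ge0 K N h d x : 0 <= Jcut K N h d x.
Proof. by rewrite mulr_ge0 ?J_ge0. Qed.

Lemma measurable_Jcut K N h d : measurable_fun setT (Jcut K N h d).
Proof.
by apply: measurable_funM; [exact: measurable_J | exact: measurable_indic].
Qed.

End model_density.

Definition Jmeasure {R : realType} (K : R) (N : \bar R) (h d : R) :
    set (measurableTypeR R) -> \bar R :=
  fun A => (\int[lebesgue_measure]_(x in A) (Jcut K N h d x)%:E)%E.

Section Jmeasure_measure.
Variables (R : realType) (K : R) (N : \bar R) (h d : R).

Let Jmeasure0 : Jmeasure K N h d set0 = 0%E.
Proof. by rewrite /Jmeasure integral_set0. Qed.

Let Jmeasure_ge0 A : (0 <= Jmeasure K N h d A)%E.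
Proof. by apply: integral_ge0 => x _; rewrite lee_fin Jcut_ge0. Qed.

Let Jmeasure_sigma_additive : semi_sigma_additive (Jmeasure K N h d).
Proof.
move=> /= A mA tA mUA; rewrite /Jmeasure/= ge0_integral_bigcup//=; first last.
- by move=> x _; rewrite lee_fin Jcut_ge0.
- by apply/measurable_EFinP; apply: measurable_funTS; exact: measurable_Jcut.
apply: is_cvg_ereal_nneg_natsum_cond => n _ _.
by apply: integral_ge0 => /= x _; rewrite lee_fin Jcut_ge0.
Qed.

HB.instance Definition _ := isMeasure.Build _ _ _
  (Jmeasure K N h d) Jmeasure0 Jmeasure_ge0 Jmeasure_sigma_additive.

End Jmeasure_measure.

Section spectral_gap.
Context {R : realType}.

Definition smooth_compact_support (f : R -> R) : Prop :=
  (forall (n : nat) (x : R), derivable (f^`(n))%classic x 1) /\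
  compact (closure [set x | f x != 0]).

Variable xi : {measure set (measurableTypeR R) -> \bar R}.
Local Open Scope ereal_scope.

(* The test is needed because [0 / 0 = 0] in [\bar R]. *)
Definition rayleigh (f : R -> R) : \bar R :=
  let den := \int[xi]_x ((f x ^+ 2)%R)%:E in
  if den == 0 then +oo else \int[xi]_x ((f^`()%classic x ^+ 2)%R)%:E / den.

Definition Lambda_Poi : \bar R :=
  ereal_inf [set rayleigh f | f in
    [set f : R -> R | [/\ smooth_compact_support f,
                          (exists x, f x != 0%R) &
                          \int[xi]_x (f x)%:E = 0]]].

End spectral_gap.

Definition lambda {R : realType} (K : R) (N : \bar R) (h d : R) : \bar R :=
  Lambda_Poi (Jmeasure K N h d).

(* Main.v *)
From HB Require Import structures.
Require Import Defs.
From mathcomp Require Import all_boot all_order all_algebra.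
From mathcomp Require Import all_classical all_reals all_analysis.
From mathcomp Require Import measurable_realfun ring lra.

Set Implicit Arguments.
Unset Strict Implicit.
Unset Printing Implicit Defensive.

Import Order.TTheory GRing.Theory Num.Theory.
Import numFieldNormedType.Exports.

Local Open Scope classical_set_scope.
Local Open Scope ring_scope.

(* Write q = (log J)'. Conjugating by the square root of J turns the Neumann
   problem on [-d/2, d/2] into the Dirichlet problem, on the same interval, for
   the Schroedinger operator - v'' + V v with V = q^2 / 4 - q' / 2, and the
   Riccati equation q' = - K - q^2 / (N - 1) gives
   V = K / 2 + (N + 1) / (4 (N - 1)) q^2. Both eigenvalues agree at the level of
   test functions: from f one takes the primitive g of f J, from g one takes a
   primitive f of - g / J, and the Cauchy-Schwarz inequality compares the
   quotients. Monotonicity in d is then the extension of Dirichlet functions by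
   zero, and N = -1 is the case where V is constant.

   For the dependence on h, only q^2 matters. Either q^2 increases pointwise with
   |h|, or changing h translates a fixed even function of x that increases with
   |x|. In the second case, let the two intervals be mirror images of each other
   in a point c: polarizing a test function of the interval farther from the
   minimum with respect to c moves its larger values to the side where the
   potential is smaller, and keeps the other two terms of the quotient. *)

(** * Derivatives, primitives and integrals of continuous functions *)

(** No eigenfunction is ever produced: gaps are compared through the levels [r] at which the form of
    - v'' + (V - r) v takes a negative value. Strict negativity survives small errors, and this
    margin pays for every smoothing: of the absolute value, of the polarized function and of the
    test functions.

    Which case of the dependence on h occurs: put t = K / (N - 1) and eta = h / (N - 1). The base u
    of J solves u'' = - t u, u(0) = 1, u'(0) = eta. If t > 0 or eta^2 < - t, then u is a multiple of
    a translate of cos or cosh, and q^2 is a translate of a multiple of tan^2 or tanh^2; moving the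
    centre does not change q^2 monotonically at each point, hence the polarization. If t <= 0 and
    eta^2 >= - t, then q^2 / (N - 1)^2 = - t + (eta^2 + t) / u^2 is at least - t, and pointwise
    comparison suffices for h of constant sign. For N = oo, q = h - K x is again a translate unless
    K = 0. *)

Section Calculus.
Context {R : realType}.
Implicit Types (f g F G : R -> R) (a b c x y : R).

Definition der f f' := forall x : R, is_derive x (1 : R) f (f' x).

Lemma der_eq f f1 f2 : der f f1 -> (forall x, f1 x = f2 x) -> der f f2.
Proof. by move=> df e x; rewrite -e. Qed.

Lemma der_cst c : der (fun=> c) (fun=> 0).
Proof. by move=> x; exact: is_derive_cst. Qed.

Lemma der_id : der (fun x => x) (fun=> 1).
Proof. by move=> x; exact: is_derive_id. Qed.

Lemma derN f f' : der f f' -> der (fun x => - f x) (fun x => - f' x).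
Proof. by move=> df x; have := df x; exact: is_deriveN. Qed.

Lemma derD f f' g g' : der f f' -> der g g' ->
  der (fun x => f x + g x) (fun x => f' x + g' x).
Proof. by move=> df dg x; have := is_deriveD (df x) (dg x). Qed.

Lemma derB f f' g g' : der f f' -> der g g' ->
  der (fun x => f x - g x) (fun x => f' x - g' x).
Proof. by move=> df dg; exact: derD df (derN dg). Qed.

Lemma is_derive_mul f g x a b : is_derive x (1 : R) f a -> is_derive x (1 : R) g b ->
  is_derive x (1 : R) (fun y => f y * g y) (a * g x + f x * b).
Proof.
move=> df dg; apply: is_derive_eq (is_deriveM df dg) _.
by rewrite /GRing.scale /= addrC mulrC.
Qed.

Lemma derM f f' g g' : der f f' -> der g g' ->
  der (fun x => f x * g x) (fun x => f' x * g x + f x * g' x).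
Proof. by move=> df dg x; exact: is_derive_mul. Qed.

Lemma der_comp f f' g g' : der f f' -> der g g' ->
  der (fun x => f (g x)) (fun x => f' (g x) * g' x).
Proof. by move=> df dg x; have := is_derive1_comp (df (g x)) (dg x). Qed.

Lemma der_expR : der (@expR R) expR.
Proof. by move=> x; exact: is_derive_expR. Qed.

Lemma is_derive_continuous f x a : is_derive x (1 : R) f a -> {for x, continuous f}.
Proof.
move=> [df _]; apply: differentiable_continuous; exact/derivable1_diffP.
Qed.

Lemma der_continuous f f' : der f f' -> continuous f.
Proof. by move=> df x; exact: is_derive_continuous (df x). Qed.

Lemma is_derive_uniq f x a b :
  is_derive x (1 : R) f a -> is_derive x (1 : R) f b -> a = b.
Proof. by move=> [_ <-] [_ <-]. Qed.

Lemma contD f g : continuous f -> continuous g -> continuous (fun x => f x + g x).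
Proof. by move=> cf cg x; apply: cvgD; [exact: cf|exact: cg]. Qed.

Lemma contN f : continuous f -> continuous (fun x => - f x).
Proof. by move=> cf x; apply: cvgN; exact: cf. Qed.

Lemma contB f g : continuous f -> continuous g -> continuous (fun x => f x - g x).
Proof. by move=> cf cg; exact: contD cf (contN cg). Qed.

Lemma contM f g : continuous f -> continuous g -> continuous (fun x => f x * g x).
Proof. by move=> cf cg x; apply: cvgM; [exact: cf|exact: cg]. Qed.

Lemma contX f n : continuous f -> continuous (fun x => f x ^+ n).
Proof.
move=> cf; elim: n => [|n ih] x.
  by under eq_fun do rewrite expr0; exact: cvg_cst.
under eq_fun do rewrite exprS.
exact: (@contM f (fun x => f x ^+ n)).
Qed.

Lemma cont_cst c : continuous (fun _ : R => c).
Proof. by move=> x; exact: cvg_cst. Qed.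

Lemma cont_id : continuous (fun x : R => x).
Proof. by move=> x; exact: cvg_id. Qed.

Lemma cont_comp f g : continuous f -> continuous g -> continuous (fun x => f (g x)).
Proof. by move=> cf cg x; apply: continuous_comp; [exact: cg|exact: cf]. Qed.

Lemma contV f : (forall x, f x != 0) -> continuous f -> continuous (fun x => (f x)^-1).
Proof. by move=> f0 cf x; apply: cvgV; [exact: f0|exact: cf]. Qed.

Lemma cont_abs f : continuous f -> continuous (fun x => `|f x|).
Proof. by move=> cf x; apply: cvg_norm; exact: cf. Qed.

Lemma cont_max f g : continuous f -> continuous g ->
  continuous (fun x => Num.max (f x) (g x)).
Proof. by move=> cf cg x; apply: continuous_max; [exact: cf|exact: cg]. Qed.

Lemma cont_min f g : continuous f -> continuous g ->
  continuous (fun x => Num.min (f x) (g x)).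
Proof. by move=> cf cg x; apply: continuous_min; [exact: cf|exact: cg]. Qed.

Lemma cont_expR f : continuous f -> continuous (fun x => expR (f x)).
Proof. by move=> cf; apply: cont_comp cf; exact: continuous_expR. Qed.

(** The fundamental theorem applies only to the right of a base point [- A]. Normalizing the
    integrals at 0 makes them independent of [A], so they glue to a primitive on the whole line. *)
Lemma exists_primitive F : continuous F -> exists G, der G F.
Proof.
move=> cF.
pose H A x : R := \int[lebesgue_measure]_(t in `[- A, x]) F t.
have intF (A u : R) : lebesgue_measure.-integrable `[- A, u] (EFin \o F).
  apply: continuous_compact_integrable; first exact: segment_compact.
  exact: continuous_subspaceT.
have dH (A x : R) : - A < x -> is_derive x (1 : R) (H A) (F x).
  move=> Ax; have [d e] := @continuous_FTC1_closed R F (- A) x (x + 1)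
    (ltr_pwDr ltr01 (lexx x)) (intF _ _) Ax (cF x).
  by apply: DeriveDef => //; rewrite -derive1E.
pose G x := H (`|x| + 1) x - H (`|x| + 1) 0.
have HE (A B x : R) : `|x| < A -> A <= B -> H A x - H A 0 = H B x - H B 0.
  move=> xA AB.
  pose K y := H A y - H B y.
  have dK (y : R) : - A < y -> is_derive y (1 : R) K 0.
    move=> Ay; have By : - B < y by apply: le_lt_trans Ay; rewrite lerN2.
    by apply: is_derive_eq (is_deriveB (dH _ _ Ay) (dH _ _ By)) _; rewrite subrr.
  have cK (u v : R) : - A < u -> u <= v -> K u = K v.
    move=> Au uv.
    have dd (y : R) : y \in `]u, v[ -> derivable K y 1.
      by rewrite in_itv /= => /andP[uy _]; have [] := dK y (lt_trans Au uy).
    have dd' (y : R) : y \in `]u, v[ -> (K^`())%classic y = 0.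
      rewrite in_itv /= => /andP[uy _]; have := dK y (lt_trans Au uy).
      by move=> [_ e]; rewrite derive1E e.
    have cc : {within `[u, v], continuous K}.
      apply: derivable_within_continuous => y; rewrite in_itv /= => /andP[uy _].
      by have [] := dK y (lt_le_trans Au uy).
    apply/eqP; rewrite eq_le; apply/andP; split.
      apply: (ger0_derive1_ndecr dd _ cc) => // y yi; by rewrite dd'.
    apply: (ler0_derive1_nincr dd _ cc) => // y yi; by rewrite dd'.
  have A0 : - A < 0 by rewrite oppr_lt0; apply: le_lt_trans xA.
  have Ax : - A < x by move: xA; rewrite ltr_norml => /andP[].
  have : K x = K 0.
    by have [x0|x0] := leP x 0; [exact: cK|apply/esym/cK => //; exact: ltW].
  rewrite /K; lra.
exists G => x0.
apply: (@near_eq_is_derive _ _ _ (fun x => H (`|x0| + 2) x - H (`|x0| + 2) 0)).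
  near=> x; rewrite /G.
  suff xx0 : `|x| < `|x0| + 1.
    by apply/esym/HE; [rewrite ltrDl|lra].
  have : `|x0 - x| < 1 by near: x; exact: (nbhsx_ballx x0 1 ltr01).
  have := ler_normB x0 (x0 - x); rewrite opprB addrC subrK; lra.
have xA : - (`|x0| + 2) < x0 by have := ler_norm (- x0); rewrite normrN; lra.
apply: is_derive_eq (is_deriveB (dH _ _ xA) (is_derive_cst _ _ _)) _.
by rewrite subr0.
Unshelve. all: by end_near. Qed.

End Calculus.
Arguments cont_cst {R} c.
Arguments cont_id {R}.

Ltac cont :=
  lazymatch goal with
  | |- continuous (fun x => - (@?f x)) => apply: (@contN _ f); cont
  | |- continuous (fun x => (@?f x) + (@?g x)) => apply: (@contD _ f g); cont
  | |- continuous (fun x => (@?f x) * (@?g x)) => apply: (@contM _ f g); cont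
  | |- continuous (fun x => (@?f x) ^+ ?n) => apply: (@contX _ f n); cont
  | |- continuous (fun x => Num.max (@?f x) (@?g x)) => apply: (@cont_max _ f g); cont
  | |- continuous (fun x => Num.min (@?f x) (@?g x)) => apply: (@cont_min _ f g); cont
  | |- continuous (fun x => expR (@?f x)) => apply: (@cont_expR _ f); cont
  | |- continuous (fun x => `| @?f x |) => apply: (@cont_abs _ f); cont
  | |- continuous _ =>
    first [ assumption | exact: cont_id | by move=> ?; exact: cvg_cst
          | lazymatch goal with
            | |- continuous (fun x => ?F (@?f x)) => apply: (@cont_comp _ F f); cont
            | |- _ => idtac
            end ]
  | |- _ => idtac
  end.

Section Integral.
Context {R : realType}.
Implicit Types (f g F G : R -> R) (a b c x y : R).

Lemma ge0_der_le G F x y : der G F -> x <= y ->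
  (forall z, x < z < y -> 0 <= F z) -> G x <= G y.
Proof.
move=> dG xy F0; apply: (@ger0_derive1_ndecr _ G x y) => //.
- by move=> z _; have [] := dG z.
- by move=> z; rewrite in_itv /= => zi; have [_ e] := dG z; rewrite derive1E e F0.
- by apply: continuous_subspaceT; exact: der_continuous dG.
Qed.

Lemma der_increment G H F x y : der G F -> der H F -> G y - G x = H y - H x.
Proof.
move=> dG dH; pose K z := G z - H z.
have dK : der K (fun=> 0).
  by apply: der_eq (derB dG dH) _ => z; rewrite subrr.
have : K x = K y by apply: is_derive_0_is_cst; exact: dK.
rewrite /K; lra.
Qed.

(* For continuous [F], the integral is the increment of a primitive; this makes
   every rule of integration a statement about derivatives. *)
Definition prim F : R -> R := xget (fun=> 0) [set G | der G F].
Definition intg F x y := prim F y - prim F x.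

Lemma primP F : continuous F -> der (prim F) F.
Proof. by move=> /exists_primitive [G GF]; exact: (@xgetI _ (fun=> 0) [set G | der G F] G). Qed.

Lemma intgE F G x y : der G F -> continuous F -> intg F x y = G y - G x.
Proof. by move=> dG cF; apply: der_increment (primP cF) dG. Qed.

Lemma intgD F G x y : continuous F -> continuous G ->
  intg (fun z => F z + G z) x y = intg F x y + intg G x y.
Proof.
move=> cF cG; rewrite (intgE _ _ (derD (primP cF) (primP cG)) (contD cF cG)).
rewrite /intg; ring.
Qed.

Lemma intgZ c F x y : continuous F -> intg (fun z => c * F z) x y = c * intg F x y.
Proof.
move=> cF; have d : der (fun z => c * prim F z) (fun z => c * F z).
  by apply: der_eq (derM (der_cst c) (primP cF)) _ => z; rewrite mul0r add0r.
rewrite (intgE _ _ d); last exact: contM (cont_cst c) cF.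
by rewrite -mulrBr.
Qed.

Lemma intgB F G x y : continuous F -> continuous G ->
  intg (fun z => F z - G z) x y = intg F x y - intg G x y.
Proof.
move=> cF cG; rewrite (intgE _ _ (derB (primP cF) (primP cG)) (contB cF cG)).
rewrite /intg; ring.
Qed.

Lemma intg_cst c x y : intg (fun=> c) x y = c * (y - x).
Proof.
have d : der (fun z => c * z) (fun=> c).
  by apply: der_eq (derM (der_cst c) der_id) _ => z; rewrite mul0r add0r mulr1.
by rewrite (intgE _ _ d (cont_cst c)) -mulrBr.
Qed.

Lemma intg_cat F x y z : intg F x z = intg F x y + intg F y z.
Proof. rewrite /intg; ring. Qed.

Lemma intg_ge0 F x y : continuous F -> x <= y ->
  (forall z, x < z < y -> 0 <= F z) -> 0 <= intg F x y.
Proof. by move=> cF xy F0; rewrite subr_ge0; exact: ge0_der_le (primP cF) xy F0. Qed.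

Lemma intg_le F G x y : continuous F -> continuous G -> x <= y ->
  (forall z, x < z < y -> F z <= G z) -> intg F x y <= intg G x y.
Proof.
move=> cF cG xy FG; rewrite -subr_ge0 -intgB //.
by apply: intg_ge0 => // [|z /FG]; [exact: contB|rewrite subr_ge0].
Qed.

Lemma intg_eq F G x y : continuous F -> continuous G -> x <= y ->
  (forall z, x < z < y -> F z = G z) -> intg F x y = intg G x y.
Proof.
move=> cF cG xy FG; apply/eqP; rewrite eq_le.
by apply/andP; split; apply: intg_le => // z /FG ->.
Qed.

Lemma intg_opp F x y : continuous F ->
  intg (fun z => F (- z)) x y = intg F (- y) (- x).
Proof.
move=> cF.
have d : der (fun z => - prim F (- z)) (fun z => F (- z)).
  apply: der_eq (derN (der_comp (primP cF) (derN der_id))) _ => z.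
  by rewrite mulrN1 opprK.
rewrite (intgE _ _ d); last exact: cont_comp cF (contN cont_id).
rewrite /intg; ring.
Qed.

Lemma intg_shift c F x y : continuous F ->
  intg (fun z => F (z + c)) x y = intg F (x + c) (y + c).
Proof.
move=> cF.
have d : der (fun z => prim F (z + c)) (fun z => F (z + c)).
  apply: der_eq (der_comp (primP cF) (derD der_id (der_cst c))) _ => z.
  by rewrite addr0 mulr1.
by rewrite (intgE _ _ d) //; exact: cont_comp cF (contD cont_id (cont_cst c)).
Qed.

Lemma intg_sym F x : continuous F ->
  intg F (- x) x = intg (fun z => F z + F (- z)) 0 x.
Proof.
move=> cF; rewrite intgD //; last exact: cont_comp cF (contN cont_id).
by rewrite intg_opp // oppr0 (intg_cat _ _ 0) addrC.
Qed.

(** The version for functions with corners at the endpoints, such as the clamped drifts below. *)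
Lemma intgE_oo (E G : R -> R) x y : x <= y -> continuous E -> continuous G ->
  (forall z, x < z < y -> is_derive z (1 : R) G (E z)) -> intg E x y = G y - G x.
Proof.
move=> xy cE cG dG; pose H z := prim E z - G z.
have dH z : z \in `]x, y[ -> is_derive z (1 : R) H 0.
  rewrite in_itv /= => zi; apply: is_derive_eq (is_deriveB (primP cE z) (dG z zi)) _.
  by rewrite subrr.
have dH1 z : z \in `]x, y[ -> derivable H z 1 by move=> /dH [].
have dH2 z : z \in `]x, y[ -> (H^`())%classic z = 0.
  by move=> /dH [_ e]; rewrite derive1E e.
have cH : {within `[x, y], continuous H}.
  apply: continuous_subspaceT; apply: contB => //; exact: der_continuous (primP cE).
have : H x = H y.
  apply/eqP; rewrite eq_le; apply/andP; split.
    by apply: (ger0_derive1_ndecr dH1 _ cH) => // z /dH2 ->.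
  by apply: (ler0_derive1_nincr dH1 _ cH) => // z /dH2 ->.
rewrite /H /intg; lra.
Qed.

Lemma intg_lebesgue F x y : x < y -> continuous F ->
  (\int[lebesgue_measure]_(z in `[x, y]) (F z)%:E = (intg F x y)%:E)%E.
Proof.
move=> xy cF; have dP := primP cF; have cP := der_continuous dP.
rewrite (@continuous_FTC2 _ F (prim F)) ?EFinB //.
- exact: continuous_subspaceT.
- split; first by move=> z _; have [] := dP z.
  + by apply: cvg_at_right_filter; exact: cP.
  + by apply: cvg_at_left_filter; exact: cP.
- by move=> z _; rewrite derive1E; have [] := dP z.
Qed.

Lemma intg_by_parts F f G g x y : der F f -> der G g ->
  continuous f -> continuous g ->
  intg (fun z => F z * g z) x y =
  F y * G y - F x * G x - intg (fun z => f z * G z) x y.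
Proof.
move=> dF dG cf cg.
have cfG := contM cf (der_continuous dG).
have cFg := contM (der_continuous dF) cg.
rewrite -(intgE x y (derM dF dG)); last exact: contD cfG cFg.
by rewrite intgD //; ring.
Qed.

Lemma cauchy_schwarz F G x y : continuous F -> continuous G -> x <= y ->
  intg (fun z => F z * G z) x y ^+ 2 <=
  intg (fun z => F z ^+ 2) x y * intg (fun z => G z ^+ 2) x y.
Proof.
move=> cF cG xy.
set A := intg (fun z => F z ^+ 2) x y; set B := intg _ x y.
set C := intg (fun z => G z ^+ 2) x y.
have cF2 : continuous (fun z => F z ^+ 2) by exact: contX.
have cG2 : continuous (fun z => G z ^+ 2) by exact: contX.
have cFG := contM cF cG.
(* This is the integral of (s F + t G)^2. At (- B, A) it equals A (A C - B^2); if A = 0, then at (-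
   (C + 1), B) it equals - (C + 2) B^2. *)
have H s t : 0 <= s ^+ 2 * A + s * t * 2 * B + t ^+ 2 * C.
  rewrite -!intgZ // -!intgD; do ?[exact: contM (cont_cst _) _|apply: contD].
  apply: intg_ge0 => // [|z _]; first by do ?[exact: contM (cont_cst _) _|apply: contD].
  rewrite (_ : _ + _ = (s * F z + t * G z) ^+ 2) ?sqr_ge0 //; ring.
have A0 : 0 <= A by have := H 1 0; lra.
have C0 : 0 <= C by have := H 0 1; lra.
have [A_eq0|A_neq0] := eqVneq A 0.
  have := H (- (C + 1)) B; have := mulr_ge0 C0 (sqr_ge0 B); rewrite A_eq0 => h1 h2.
  suff -> : B = 0 by rewrite mul0r expr0n.
  apply/eqP; rewrite -sqrf_eq0 eq_le sqr_ge0 andbT; nra.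
have Apos : 0 < A by rewrite lt_neqAle eq_sym A_neq0.
rewrite -subr_ge0 -(pmulr_rge0 _ Apos); have := H (- B) A; nra.
Qed.

Lemma segment_bounded F x y : continuous F -> exists2 M, 0 < M &
  forall z, x <= z <= y -> `|F z| <= M.
Proof.
move=> cF; have [xy|yx] := leP x y; last first.
  exists 1 => // z /andP[xz zy]; have := le_trans xz zy; lra.
have [c _ cmax] := EVT_max xy (continuous_subspaceT (cont_abs cF)).
exists (`|F c| + 1) => [|z zi]; first by rewrite ltr_pwDr.
by apply: le_trans (cmax z _) _; [rewrite in_itv|rewrite lerDl].
Qed.

End Integral.

(** * C1 functions: gluing, and a smoothed absolute value *)

Section C1.
Context {R : realType}.
Implicit Types (f g F G v w : R -> R) (a b c x y : R).

Definition C1 f f' := der f f' /\ continuous f'.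

Lemma C1_local h h' : (forall x, exists f f', C1 f f' /\
    exists2 e : R, 0 < e & forall y, `|x - y| < e -> h y = f y /\ h' y = f' y) ->
  C1 h h'.
Proof.
move=> H; split=> x; have [f [f' [[df cf] [e e0 hf]]]] := H x.
  have [_ ->] : h x = f x /\ h' x = f' x by apply: hf; rewrite subrr normr0.
  apply: near_eq_is_derive (df x); near=> y.
  suff /hf [-> _] : `|x - y| < e by [].
  by near: y; exact: (nbhsx_ballx x e e0).
have [_ hx] : h x = f x /\ h' x = f' x by apply: hf; rewrite subrr normr0.
have : (f' y @[y --> x] --> h' x) by rewrite hx; exact: cf.
apply: cvg_trans; apply: near_eq_cvg; near=> y.
suff /hf [_ ->] : `|x - y| < e by [].
by near: y; exact: (nbhsx_ballx x e e0).
Unshelve. all: by end_near. Qed.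

(** Agreement near [c] makes the derivatives agree there too. It is available because the pieces are
    flattened by [soft_abs] before they are glued. *)
Lemma C1_glue f f' g g' c e : C1 f f' -> C1 g g' -> 0 < e ->
  (forall z, `|c - z| < e -> f z = g z) ->
  C1 (fun z => if z < c then f z else g z) (fun z => if z < c then f' z else g' z).
Proof.
move=> Cf Cg e0 fg.
have fg' z : `|c - z| < e -> f' z = g' z.
  move=> cz; apply: (is_derive_uniq _ (Cg.1 z)).
  apply: near_eq_is_derive (Cf.1 z); near=> y; apply: fg.
  have : `|z - y| < e - `|c - z|.
    by near: y; apply: (nbhsx_ballx z (e - `|c - z|)); rewrite subr_gt0.
  have := ler_normD (c - z) (z - y); rewrite addrA subrK; lra.
apply: C1_local => x; have [xc|cx|->] := ltgtP x c.
- exists f, f'; split=> //; exists (c - x); rewrite ?subr_gt0 // => y.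
  by rewrite ltr_norml => /andP[h _]; rewrite (_ : y < c) //; lra.
- exists g, g'; split=> //; exists (x - c); rewrite ?subr_gt0 // => y.
  rewrite ltr_norml => /andP[_ h]; rewrite (_ : y < c = false) //; apply/negbTE; lra.
- exists g, g'; split=> //; exists e => // y cy.
  by case: ifP => // _; rewrite fg // fg'.
Unshelve. all: by end_near. Qed.

Lemma C1_comp f f' g g' : C1 f f' -> C1 g g' ->
  C1 (fun x => f (g x)) (fun x => f' (g x) * g' x).
Proof.
move=> [df cf] [dg cg]; split; first exact: der_comp.
have := der_continuous dg => cg0; cont.
Qed.

Lemma C1_zero : C1 (fun=> 0) (fun=> 0).
Proof. by split; [exact: der_cst|exact: cont_cst]. Qed.

(* Vanishing near 0 is what keeps [psi \o v] C1 when it is cut off at a zero of [v]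
   or when its sign is switched there. *)
Lemma soft_abs e : 0 < e -> exists psi psi' : R -> R,
  [/\ C1 psi psi', forall t, `|psi' t| <= 1, forall t, `|t| <= e -> psi t = 0,
      forall t, psi (- t) = psi t /\ psi' (- t) = - psi' t &
      forall t, `|t| - 2 * e <= psi t <= `|t| /\ 0 <= psi t].
Proof.
move=> e0.
(* [r] is the ramp from 0 at [e] to 1 at [2 * e], so [th] is a continuous odd approximation of the
   sign, and its primitive [psi] falls short of the absolute value by at most [2 * e]. *)
pose r t := Num.max 0 (Num.min 1 (t / e - 1)).
pose th t := r t - r (- t).
have cr : continuous r by rewrite /r; cont.
have cth : continuous th by rewrite /th; cont.
have r0 t : 0 <= r t by rewrite le_max lexx.
have r1 t : r t <= 1 by rewrite ge_max ler01 ge_min lexx.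
have rz t : t <= e -> r t = 0.
  move=> te; rewrite /r; apply/max_idPl; rewrite ge_min; apply/orP; right.
  by rewrite subr_le0 ler_pdivrMr // mul1r.
have rone t : 2 * e <= t -> r t = 1.
  move=> te; rewrite /r (_ : Num.min _ _ = 1); first by apply/max_idPr; rewrite ler01.
  by apply/min_idPl; rewrite lerBrDr ler_pdivlMr //; lra.
pose psi t := prim th t - prim th 0.
have psiE t : psi t = intg th 0 t by [].
have dpsi : der psi th.
  apply: der_eq (derB (primP cth) (der_cst (prim th 0))) _ => t; exact: subr0.
have thN t : th (- t) = - th t by rewrite /th opprK opprB.
have psiN t : psi (- t) = psi t.
  have := intg_opp 0 t cth; rewrite oppr0 => h.
  have : intg (fun z => th (- z)) 0 t = - intg th 0 t.
    under [in LHS]eq_fun do rewrite thN -mulN1r.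
    by rewrite intgZ // mulN1r.
  by rewrite h /psi /intg => ?; lra.
have thpos t : 0 <= t -> 0 <= th t <= 1.
  move=> t0; rewrite /th (rz (- t)) ?subr0 ?r0 ?r1 //; lra.
have psiz t : 0 <= t -> t <= e -> psi t = 0.
  move=> t0 te; rewrite psiE (@intg_eq _ _ (fun=> 0)) ?intg_cst ?mul0r //; first exact: cont_cst.
  by move=> z /andP[z0 zt]; rewrite /th !rz ?subr0 //; lra.
have psib t : 0 <= t -> t - 2 * e <= psi t <= t /\ 0 <= psi t.
  move=> t0; have p0 : 0 <= psi t.
    by rewrite psiE; apply: intg_ge0 => // z /andP[z0 _]; have /andP[] := thpos z (ltW z0).
  have pt : psi t <= t.
    rewrite psiE -[leRHS]subr0 -[leRHS]mul1r -intg_cst; apply: intg_le => //; first exact: cont_cst.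
    by move=> z /andP[z0 _]; have /andP[] := thpos z (ltW z0).
  split=> //; rewrite pt andbT.
  have [te|te] := leP t (2 * e); first by apply: le_trans p0; rewrite subr_le0.
  have -> : psi t = psi (2 * e) + intg th (2 * e) t by rewrite !psiE -intg_cat.
  apply: (@le_trans _ _ (intg th (2 * e) t)).
    rewrite -[leLHS]mul1r -intg_cst; apply: intg_le => //; [exact: cont_cst|exact: ltW|].
    by move=> z /andP[z0 _]; rewrite /th rone ?rz ?subr0 //; lra.
  rewrite lerDr psiE; apply: intg_ge0 => //; first by lra.
  by move=> z /andP[z0 _]; have /andP[] := thpos z (ltW z0).
exists psi, th; split=> //.
- move=> t; have [t0|t0] := leP 0 t.
    by have /andP[h1 h2] := thpos t t0; rewrite ger0_norm.
  have Nt : 0 <= - t by lra.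
  by rewrite -normrN -thN; have /andP[h1 h2] := thpos _ Nt; rewrite ger0_norm.
- move=> t; have [t0|t0] := leP 0 t; first by rewrite ger0_norm //; exact: psiz.
  by rewrite ltr0_norm // => h; rewrite -psiN; apply: psiz => //; lra.
- move=> t; have [t0|t0] := leP 0 t; first by rewrite ger0_norm //; exact: psib.
  by rewrite ltr0_norm // -psiN; apply: psib; lra.
Qed.

Lemma C1_eq_deriv a F F1 T T1 : C1 F F1 -> C1 T T1 -> (forall x, - a <= x <= a -> T x = F x) ->
  forall x, - a < x < a -> T1 x = F1 x.
Proof.
move=> [dF _] [dT _] TF x /andP[x1 x2]; apply: is_derive_uniq (dT x) _.
have r0 : 0 < Num.min (x + a) (a - x) by rewrite lt_min; apply/andP; split; lra.
apply: near_eq_is_derive (dF x); near=> y; apply/esym/TF.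
have : `|x - y| < Num.min (x + a) (a - x) by near: y; exact: (nbhsx_ballx x _ r0).
by rewrite lt_min !ltr_norml => /andP[/andP[? ?] /andP[? ?]]; apply/andP; split; lra.
Unshelve. all: by end_near. Qed.

End C1.

(** * Dirichlet forms and polarization *)

Section Negative.
Context {R : realType}.
Implicit Types (f g F G v w W : R -> R) (a b c x y : R).

(* The quadratic form of [- v'' + W v] takes a negative value on the Dirichlet
   functions of [-a, a]. *)
Definition negative W a := exists v v' : R -> R,
  [/\ C1 v v', forall x, 0 <= v x, forall x, a <= `|x| -> v x = 0 &
      intg (fun x => v' x ^+ 2 + W x * v x ^+ 2) (- a) a < 0].

Lemma cont_energy W v v' : continuous W -> C1 v v' ->
  continuous (fun x => v' x ^+ 2 + W x * v x ^+ 2).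
Proof. by move=> cW [/der_continuous cv cv']; cont. Qed.

(** Chooses the smoothing parameter: a negative energy [g] stays negative after an error
    proportional to [e]. *)
Lemma small_slope (g c : R) : g < 0 -> 0 <= c -> exists2 e, 0 < e & g + c * e < 0.
Proof.
move=> g0 c0; exists (- g / (c + 1)); first by rewrite divr_gt0 //; lra.
have c1 : 0 < c + 1 by lra.
rewrite -(pmulr_llt0 _ c1) mulrDl -mulrA divfK ?gt_eqF //; nra.
Qed.

Lemma continuous_modulus F c e : continuous F -> 0 < e ->
  exists2 d, 0 < d & forall z, `|c - z| < d -> `|F c - F z| < e.
Proof.
move=> cF e0; have /cvgrPdist_lt /(_ e e0) := cF c.
by move=> /nbhs_ballP [d d0 h]; exists d => // z cz; exact: h.
Qed.

Lemma sqr_perturb (B M e m n w : R) : `|w| <= B -> 0 <= m <= M -> 0 <= n <= M ->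
  `|m - n| <= e -> w * m ^+ 2 <= w * n ^+ 2 + 2 * B * M * e.
Proof.
move=> wB /andP[m0 mM] /andP[n0 nM] mn.
rewrite -lerBlDl -mulrBr; apply: le_trans (ler_norm _) _.
rewrite normrM subr_sqr normrM (ger0_norm (addr_ge0 m0 n0)).
rewrite (_ : 2 * B * M * e = B * (e * (2 * M))); last by ring.
apply: ler_pM => //; first by rewrite mulr_ge0 // addr_ge0.
by apply: ler_pM => //; [exact: addr_ge0|lra].
Qed.

Lemma sqr_perturb_norm (B M e m n w : R) : `|w| <= B -> `|m| <= M -> `|n| <= M ->
  `|m - n| <= e -> w * m ^+ 2 <= w * n ^+ 2 + 2 * B * M * e.
Proof.
move=> wB mM nM mn.
rewrite -(real_normK (num_real m)) -(real_normK (num_real n)).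
by apply: sqr_perturb; rewrite ?normr_ge0 //; exact: le_trans (ler_dist_dist _ _) mn.
Qed.

(** Neither the absolute value of [v] nor its extension by zero need be C1. Composing [v] with a
    smoothed absolute value that vanishes near 0 cures both, does not increase the derivative, and
    changes the potential term by O(e). *)
Lemma negative_of_C1 W a v v' : 0 < a -> continuous W -> C1 v v' ->
  v (- a) = 0 -> v a = 0 ->
  intg (fun x => v' x ^+ 2 + W x * v x ^+ 2) (- a) a < 0 -> negative W a.
Proof.
move=> a0 cW Cv vNa va I0; have cv := der_continuous Cv.1.
have [M M0 hM] := segment_bounded (- a) a cv.
have [B B0 hB] := segment_bounded (- a) a cW.
(* The pointwise error [2 * B * M * (2 * e)] of [sqr_perturb], on an interval of length [2 * a]. *)
have [|e e0 he] := @small_slope _ (2 * B * M * 2 * (2 * a)) I0.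
  by rewrite !mulr_ge0 // ltW.
have [psi [psi' [Cpsi psi1 psiz _ psib]]] := soft_abs e0.
have [d1 d10 hd1] := continuous_modulus (- a) cv e0.
have [d2 d20 hd2] := continuous_modulus a cv e0.
have Cu := C1_comp Cpsi Cv.
have h2 z : `|a - z| < d2 -> psi (v z) = 0.
  by move=> /hd2; rewrite va sub0r normrN => h; rewrite psiz // ltW.
have Cu2 := C1_glue Cu C1_zero d20 h2.
have d30 : 0 < Num.min d1 (2 * a) by rewrite lt_min d10 /=; lra.
have h1 z : `|- a - z| < Num.min d1 (2 * a) -> 0 = (if z < a then psi (v z) else 0).
  rewrite lt_min => /andP[/hd1]; rewrite vNa sub0r normrN => h.
  rewrite ltr_norml => /andP[h3 _]; rewrite (_ : z < a); last lra.
  by rewrite psiz // ltW.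
have Cw := C1_glue C1_zero Cu2 d30 h1.
eexists; eexists; split; first exact: Cw.
- by move=> x /=; do 2 case: ifP => // _; have [] := psib (v x).
- move=> x ax /=; case: (ltP x (- a)) => // x1; case: (ltP x a) => // x2.
  move: ax; rewrite ler_normr => /orP[|] h; first by move: x2; rewrite ltNge h.
  have -> : x = - a by apply/eqP; rewrite eq_le x1 andbT; lra.
  by rewrite vNa psiz // normr0 ltW.
apply: le_lt_trans he.
rewrite (_ : 2 * B * M * 2 * (2 * a) * e = 2 * B * M * (2 * e) * (a - - a)); last ring.
rewrite -intg_cst -intgD; [|exact: cont_energy|exact: cont_cst].
apply: intg_le; [exact: cont_energy|apply: contD; [exact: cont_energy|exact: cont_cst]|lra|].
move=> z /andP[z1 z2] /=; rewrite z2 ltNge (ltW z1) /= -addrA lerD //.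
  rewrite exprMn ler_piMl ?sqr_ge0 // -[leRHS](expr1n _ 2) -[leLHS]real_normK ?num_real //.
  by rewrite lerXn2r ?nnegrE.
have zi : - a <= z <= a by rewrite !ltW.
have [/andP[p1 p2] p0] := psib (v z).
rewrite -[in leRHS](real_normK (num_real (v z))).
apply: sqr_perturb; rewrite ?hB // ?p0 ?normr_ge0 ?hM //=.
  exact: le_trans p2 (hM _ zi).
by rewrite ler_norml; apply/andP; split; lra.
Qed.

Lemma eq_negative W1 W2 a : 0 < a -> continuous W1 -> continuous W2 ->
  (forall x, - a < x < a -> W2 x <= W1 x) -> negative W1 a -> negative W2 a.
Proof.
move=> a0 c1 c2 h [v [v' [Cv v0 vz I]]]; exists v, v'; split => //.
apply: le_lt_trans I; apply: intg_le; [exact: cont_energy..|lra|].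
by move=> z /h zi; rewrite lerD2l ler_wpM2r // sqr_ge0.
Qed.

Lemma C1_support v v' a x : C1 v v' -> (forall x, a <= `|x| -> v x = 0) ->
  a < `|x| -> v' x = 0.
Proof.
move=> [dv _] v0 ax; apply: is_derive_uniq (dv x) _.
apply: near_eq_is_derive (is_derive_cst 0 _ _); near=> y.
rewrite v0 //.
have : `|x - y| < `|x| - a.
  by near: y; apply: (nbhsx_ballx x (`|x| - a)); rewrite subr_gt0.
have := ler_normD (x - y) y; rewrite subrK; lra.
Unshelve. all: by end_near. Qed.

Lemma energy_support W v v' a b : continuous W -> C1 v v' -> 0 < a -> a <= b ->
  (forall x, a <= `|x| -> v x = 0) ->
  intg (fun x => v' x ^+ 2 + W x * v x ^+ 2) (- b) b =
  intg (fun x => v' x ^+ 2 + W x * v x ^+ 2) (- a) a.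
Proof.
move=> cW Cv a0 ab v0; have cE := cont_energy cW Cv.
have z0 x : a < `|x| -> v' x ^+ 2 + W x * v x ^+ 2 = 0.
  by move=> ax; rewrite (C1_support Cv v0) // v0 ?ltW // expr0n mulr0 addr0.
have i0 x y : x <= y -> (forall z, x < z < y -> a < `|z|) ->
    intg (fun x => v' x ^+ 2 + W x * v x ^+ 2) x y = 0.
  move=> xy h; rewrite (@intg_eq _ _ (fun=> 0)) ?intg_cst ?mul0r //; first exact: cont_cst.
  by move=> z /h; exact: z0.
rewrite (intg_cat _ _ (- a)) (intg_cat _ (- a) a) (i0 (- b)) ?(i0 a) ?add0r ?addr0 //.
- by move=> z /andP[az _]; rewrite ltr_normr az.
- by rewrite lerN2.
- by move=> z /andP[_ az]; rewrite ltr_normr; apply/orP; right; lra.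
Qed.

Lemma negative_widen W a b : continuous W -> 0 < a -> a <= b ->
  negative W a -> negative W b.
Proof.
move=> cW a0 ab [v [v' [Cv v0 vz I]]]; exists v, v'; split => //.
  by move=> x bx; apply: vz; exact: le_trans bx.
by rewrite (energy_support _ _ a0).
Qed.

Lemma negative_opp W a : 0 < a -> continuous W ->
  negative W a -> negative (fun x => W (- x)) a.
Proof.
move=> a0 cW [v [v' [Cv v0 vz I]]].
have CN : C1 (-%R : R -> R) (fun=> - 1).
  by split; [exact: derN der_id|exact: cont_cst].
eexists; eexists; split; first exact: C1_comp Cv CN.
- by move=> x; exact: v0.
- by move=> x ax /=; apply: vz; rewrite normrN.
have cE := cont_energy cW Cv.
have := intg_opp (- a) a cE; rewrite opprK => e; rewrite -e in I.
by apply: le_lt_trans I; under eq_fun do rewrite mulrN1 sqrrN.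
Qed.

End Negative.

(** * Polarization about the origin *)

Section Polarization.
Context {R : realType}.
Implicit Types (f g F G v w W : R -> R) (a b c x y : R).

(** With s = 1 and s = -1 these are the even part S and the odd part T, for which the minimum and
    maximum of the values at z and - z are S - |T| and S + |T|. *)
Lemma C1_even_odd (s : R) v v' : s * s = 1 -> C1 v v' ->
  C1 (fun z => (v z + s * v (- z)) / 2) (fun z => (v' z - s * v' (- z)) / 2).
Proof.
move=> s1 [dv cv']; split; last by cont.
apply: der_eq (derM (derD dv (derM (der_cst s) (der_comp dv (derN der_id)))) (der_cst 2^-1)) _.
move=> x /=; ring.
Qed.

Lemma C1_add v v' w w' : C1 v v' -> C1 w w' ->
  C1 (fun z => v z + w z) (fun z => v' z + w' z).
Proof. by move=> [dv cv] [dw cw]; split; [exact: derD|cont]. Qed.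

Lemma C1_opp v v' : C1 v v' -> C1 (fun z => - v z) (fun z => - v' z).
Proof. by move=> [dv cv]; split; [exact: derN|cont]. Qed.

Lemma C1_translate c v v' : C1 v v' -> C1 (fun z => v (z + c)) (fun z => v' (z + c)).
Proof.
move=> [dv cv]; split; last by cont.
apply: der_eq (der_comp dv (derD der_id (der_cst c))) _ => x.
by rewrite addr0 mulr1.
Qed.

(* [p, l] are the values of a function at [z, -z], and [X, Y] those of its
   smoothed polarization, which approximate [min p l] and [max p l]. *)
Lemma polarized_potential (w1 w2 p l X Y e M B : R) :
  w2 <= w1 -> `|w1| <= B -> `|w2| <= B -> 0 <= p <= M -> 0 <= l <= M ->
  0 <= X <= M -> 0 <= Y <= M ->
  `|X - ((p + l) / 2 - `|(p - l) / 2|)| <= e ->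
  `|Y - ((p + l) / 2 + `|(p - l) / 2|)| <= e ->
  w1 * X ^+ 2 + w2 * Y ^+ 2 <= w1 * p ^+ 2 + w2 * l ^+ 2 + 4 * B * M * e.
Proof.
move=> w21 B1 B2 pM lM XM YM hX hY.
have [pl|lp] := leP p l.
  rewrite (@ler0_norm _ ((p - l) / 2)) in hX hY; last lra.
  rewrite (_ : _ / 2 - _ = p) in hX; last by field.
  rewrite (_ : _ / 2 + _ = l) in hY; last by field.
  have := sqr_perturb B1 XM pM hX; have := sqr_perturb B2 YM lM hY; lra.
(* The rearrangement inequality: the larger value is better placed at the smaller weight. *)
have swap : w1 * l ^+ 2 + w2 * p ^+ 2 <= w1 * p ^+ 2 + w2 * l ^+ 2.
  move: lM pM => /andP[l0 _] /andP[p0 _].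
  rewrite -subr_ge0 (_ : _ - _ = (w1 - w2) * (p ^+ 2 - l ^+ 2)); last by ring.
  by rewrite mulr_ge0 ?subr_ge0 // lerXn2r // ltW.
rewrite (@ger0_norm _ ((p - l) / 2)) in hX hY; last lra.
rewrite (_ : _ / 2 - _ = l) in hX; last by field.
rewrite (_ : _ / 2 + _ = p) in hY; last by field.
have := sqr_perturb B1 XM lM hX; have := sqr_perturb B2 YM pM hY; lra.
Qed.

(** [P] is the smoothed |T|, short by at most [2 * e]; [X] and [Y] come from a second smoothing at
    level [2 * e], short by at most [4 * e]. Together this makes [6 * e]. *)
Lemma polarized_values (S T P X Y e M : R) : 0 < e ->
  `|T| <= S -> S + `|T| <= M -> `|T| - 2 * e <= P -> P <= `|T| -> 0 <= P ->
  S - P - 2 * (2 * e) <= X -> X <= S - P -> 0 <= X ->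
  S + P - 2 * (2 * e) <= Y -> Y <= S + P -> 0 <= Y ->
  [/\ 0 <= X <= M, 0 <= Y <= M, `|X - (S - `|T|)| <= 6 * e & `|Y - (S + `|T|)| <= 6 * e].
Proof.
have := normr_ge0 T; set A := `|T| => *.
by split; rewrite ?ler_norml; apply/andP; split; lra.
Qed.

(* Polarization of the test function with respect to the midpoint 0 of the two
   intervals: for z > 0, the pair of its values at z and -z is rearranged so
   that the larger one sits at -z, where the potential is smaller. *)
Lemma polarization W a b : continuous W -> 0 < a -> 0 <= b ->
  (forall z, 0 <= z -> W (- z) <= W z) ->
  negative (fun x => W (x + b)) a -> negative (fun x => W (x - b)) a.
Proof.
move=> cW a0 b0 hW [v [v' [Cv vge0 vz I]]].
(* In the coordinate centred at the mirror point, the given function lives on [b - a, b + a] and the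
   polarized one has to live on [- b - a, a - b]; [- A, A] contains both. *)
pose A := a + b.
pose p z := v (z - b); pose p' z := v' (z - b).
have Cp : C1 p p' by exact: C1_translate.
have pge0 z : 0 <= p z by exact: vge0.
have pz z : a <= `|z - b| -> p z = 0 by exact: vz.
have cp := der_continuous Cp.1; have cp' := Cp.2.
pose H z := p' z ^+ 2 + W z * p z ^+ 2.
have cH : continuous H by exact: cont_energy.
have IH : intg H (- A) A < 0.
  have cWb : continuous (fun x => W (x + b)) by cont.
  (* The shift by [b] turns [- A, A] into [- (a + 2 b), a], so the support is first widened to
     [a + 2 * b]. *)
  have h2 : a <= a + 2 * b by lra.
  have := energy_support cWb Cv a0 h2 vz; set E := (fun x => _) => e.
  have cE : continuous E by exact: cont_energy.
  have -> : H = fun z => E (z - b).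
    by apply/funext => z; rewrite /E subrK.
  rewrite intg_shift //.
  have e0 : intg E a (a + 2 * b) = 0.
    rewrite (@intg_eq _ _ (fun=> 0)) ?intg_cst ?mul0r //; first exact: cont_cst.
    move=> z /andP[az _]; have az' : a < `|z| by rewrite ltr_normr az.
    by rewrite /E (C1_support Cv vz) // vz ?ltW // expr0n mulr0 addr0.
  have := intg_cat E (- (a + 2 * b)) a (a + 2 * b); rewrite e0 addr0 e => h.
  have e1 : - A - b = - (a + 2 * b) by rewrite /A; ring.
  have e2 : A - b = a by rewrite /A; ring.
  by rewrite e1 e2 -h.
have A0 : 0 < A by rewrite /A; lra.
have [M M0 hM] := segment_bounded (- A) A cp.
have [B B0 hB] := segment_bounded (- A) A cW.
(* The error [4 * B * M * (6 * e)] of [polarized_potential], integrated over [0, A]. *)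
have [|e e0 he] := @small_slope _ _ (4 * B * M * 6 * A) IH.
  by rewrite !mulr_ge0 // ltW.
have [psi [psi' [Cpsi psi1 psiz psiN psib]]] := soft_abs e0.
(* Where p(- z) = 0, the true minimum S - |T| vanishes but S - psi(T) can be as large as [2 * e].
   The second cutoff [chi], zero up to [2 * e], restores the support. *)
have e20 : 0 < 2 * e by lra.
have [chi [chi' [Cchi chi1 chiz _ chib]]] := soft_abs e20.
pose S z := (p z + 1 * p (- z)) / 2; pose S' z := (p' z - 1 * p' (- z)) / 2.
pose T z := (p z + (-1) * p (- z)) / 2; pose T' z := (p' z - (-1) * p' (- z)) / 2.
have CS : C1 S S' by apply: C1_even_odd => //; rewrite mul1r.
have CT : C1 T T' by apply: C1_even_odd => //; rewrite mulrNN mul1r.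
have Cq := C1_comp Cpsi CT.
have TN z : T (- z) = - T z by rewrite /T opprK; field.
have T'N z : T' (- z) = T' z by rewrite /T' opprK; field.
have SN z : S (- z) = S z by rewrite /S opprK; field.
have S'N z : S' (- z) = - S' z by rewrite /S' opprK; field.
have [d d0 hd] := continuous_modulus 0 (der_continuous CT.1) e0.
have T0 : T 0 = 0 by rewrite /T oppr0; field.
(* T vanishes at 0, so psi(T) vanishes near 0 and may change sign there: [w1] is the smoothed
   maximum for z < 0 and the smoothed minimum for z >= 0. *)
have hd' z : `|0 - z| < d -> psi (T z) = - psi (T z).
  by move=> /hd; rewrite T0 sub0r normrN => h; rewrite psiz ?oppr0 // ltW.
have Cw1 := C1_add CS (C1_glue Cq (C1_opp Cq) d0 hd').
have Cw := C1_comp Cchi Cw1.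
set w1 := (fun z => S z + _) in Cw1 Cw; set w1' := (fun z => S' z + _) in Cw1 Cw.
set w := (fun z => chi (w1 z)) in Cw; set w' := (fun z => chi' (w1 z) * w1' z) in Cw.
have w1p z : 0 <= z -> w1 z = S z - psi (T z).
  by move=> z0; rewrite /w1 ltNge z0.
have w1n z : 0 < z -> w1 (- z) = S z + psi (T z).
  by move=> z0; rewrite /w1 oppr_lt0 z0 SN TN; case: (psiN (T z)) => ->.
have w1'p z : 0 < z -> w1' z = S' z - psi' (T z) * T' z.
  by move=> z0; rewrite /w1' ltNge (ltW z0).
have w1'n z : 0 < z -> w1' (- z) = - (S' z + psi' (T z) * T' z).
  move=> z0; rewrite /w1' oppr_lt0 z0 S'N TN T'N; case: (psiN (T z)) => _ ->.
  by ring.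
have TS z : `|T z| <= S z.
  by rewrite ler_norml /S /T; have := pge0 z; have := pge0 (- z) => ? ?; apply/andP; split; lra.
have wz z : a <= `|z + b| -> w z = 0.
  move=> az; apply: chiz.
  have [z0|z0] := leP 0 z.
    have az' : a <= z + b by rewrite ger0_norm in az => //; lra.
    rewrite w1p // /S /T.
    have -> : p (- z) = 0 by apply: pz; rewrite ler_normr; apply/orP; right; lra.
    rewrite !mulr0 !addr0; have [/andP[h1 h2] h3] := psib (p z / 2).
    have p2 : 0 <= p z / 2 by rewrite divr_ge0.
    by rewrite (ger0_norm p2) in h1 h2; rewrite ger0_norm; lra.
  have -> : w1 z = S (- z) + psi (T (- z)) by rewrite -w1n ?oppr_gt0 // opprK.
  rewrite SN TN; case: (psiN (T z)) => -> _.
  move: az; rewrite ler_normr => /orP[az|az].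
    suff [pz1 pz2] : p z = 0 /\ p (- z) = 0.
      by rewrite /S /T pz1 pz2 !mulr0 addr0 mul0r psiz ?normr0 ?addr0 ?normr0 ?ltW.
    by split; apply: pz; rewrite ler_normr; apply/orP; right; lra.
  suff [pz1 pz2] : p z = 0 /\ p (- z) = 0.
    by rewrite /S /T pz1 pz2 !mulr0 addr0 mul0r psiz ?normr0 ?addr0 ?normr0 ?ltW.
  by split; apply: pz; rewrite ler_normr; apply/orP; [right|left]; lra.
have Cwb := C1_translate (- b) Cw.
exists (fun x => w (x - b)), (fun x => w' (x - b)); split=> //.
- by move=> x; have [] := chib (w1 (x - b)).
- by move=> x ax; apply: wz; rewrite subrK.
pose K z := w' z ^+ 2 + W z * w z ^+ 2.
have cK : continuous K by exact: cont_energy.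
rewrite (_ : (fun x => _) = (fun x => K (x - b))) // intg_shift //.
have -> : intg K (- a - b) (a - b) = intg K (- A) A.
  rewrite (_ : - a - b = - A); last by rewrite /A; ring.
  suff IKz : intg K (a - b) A = 0 by rewrite (intg_cat _ _ (a - b) A) IKz addr0.
  have bA : a - b <= A by rewrite /A; lra.
  rewrite (@intg_eq _ _ (fun=> 0) _ _ cK (cont_cst 0) bA) ?intg_cst ?mul0r //.
  move=> z /andP[z1 z2].
  have z3 : a < `|z + b| by rewrite ltr_normr; apply/orP; left; lra.
  have := @C1_support _ (fun x => w (x - b)) (fun x => w' (x - b)) a (z + b) Cwb.
  rewrite addrK => hs; rewrite /K hs //; last by move=> x ax; apply: wz; rewrite subrK.
  by rewrite (wz z (ltW z3)) expr0n mulr0 addr0.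
rewrite intg_sym // in IH he; rewrite intg_sym //.
apply: le_lt_trans he.
rewrite (_ : 4 * B * M * 6 * A * e = 4 * B * M * (6 * e) * (A - 0)); last ring.
have cHH : continuous (fun z => H z + H (- z)) by cont.
have cKK : continuous (fun z => K z + K (- z)) by cont.
rewrite -intg_cst -intgD; [|exact: cHH|exact: cont_cst].
apply: intg_le; [exact: cKK|apply: contD; [exact: cHH|exact: cont_cst]|exact: ltW|].
move=> z /andP[z0 zA].
have kin t : w' t ^+ 2 <= w1' t ^+ 2.
  rewrite exprMn ler_piMl ?sqr_ge0 // -[leRHS](expr1n _ 2) -[leLHS]real_normK ?num_real //.
  by rewrite lerXn2r ?nnegrE.
(* By the parallelogram law the right side is 2 S'^2 + 2 T'^2; polarizing only multiplies T' by the
   factor psi'(T), of absolute value at most 1. *)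
have K1 : w' z ^+ 2 + w' (- z) ^+ 2 <= p' z ^+ 2 + p' (- z) ^+ 2.
  apply: le_trans (lerD (kin _) (kin _)) _; rewrite w1'p // w1'n //.
  have -> : p' z ^+ 2 + p' (- z) ^+ 2 = 2 * S' z ^+ 2 + 2 * T' z ^+ 2.
    by rewrite /S' /T'; field.
  have : psi' (T z) ^+ 2 <= 1 by rewrite -real_normK ?num_real // expr_le1.
  have := sqr_ge0 (T' z); nra.
have zi : - A <= z <= A by apply/andP; split; lra.
have zi' : - A <= - z <= A by apply/andP; split; lra.
have pM : 0 <= p z <= M by rewrite pge0 (le_trans (ler_norm _) (hM _ zi)).
have lM : 0 <= p (- z) <= M by rewrite pge0 (le_trans (ler_norm _) (hM _ zi')).
have [/andP[q1 q2] q3] := psib (T z).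
have hTS := TS z.
have nT0 := normr_ge0 (T z).
have STM : S z + `|T z| <= M.
  move: pM lM => /andP[? ?] /andP[? ?].
  by rewrite -lerBrDl ler_norml /S /T; apply/andP; split; lra.
have w10 : 0 <= w1 z by rewrite (w1p z (ltW z0)); lra.
have w11 : 0 <= w1 (- z) by rewrite w1n //; lra.
have [/andP[c1 c2] c3] := chib (w1 z); have [/andP[c4 c5] c6] := chib (w1 (- z)).
rewrite (ger0_norm w10) in c1 c2; rewrite (ger0_norm w11) in c4 c5.
rewrite -/(w z) -/(w (- z)) in c1 c2 c3 c4 c5 c6.
rewrite (w1p z (ltW z0)) in c1 c2; rewrite w1n // in c4 c5.
have eS : (p z + p (- z)) / 2 = S z by rewrite /S mul1r.
have eT : (p z - p (- z)) / 2 = T z by rewrite /T mulN1r.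
have := @polarized_potential (W z) (W (- z)) (p z) (p (- z)) (w z) (w (- z)) (6 * e) M B
  (hW _ (ltW z0)) (hB _ zi) (hB _ zi') pM lM.
rewrite eS eT => PP.
have [v1 v2 v3 v4] := polarized_values e0 hTS STM q1 q2 q3 c1 c2 c3 c4 c5 c6.
by move: K1 (PP v1 v2 v3 v4); rewrite /K /H; clear; lra.
Qed.

End Polarization.

(** * Translates of an even potential *)

Section Translation.
Context {R : realType}.
Implicit Types (W : R -> R) (a t : R).

Lemma negative_even_translate W a t : continuous W -> 0 < a -> (forall y, W (- y) = W y) ->
  negative (fun x => W (x + t)) a -> negative (fun x => W (x - t)) a.
Proof.
move=> cW a0 Wev n; have cWt : continuous (fun x => W (x + t)) by cont.
rewrite (_ : (fun x => _) = (fun x => W (- x + t))); first exact: negative_opp n.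
by apply/funext => x; rewrite -Wev opprB addrC.
Qed.

Lemma negative_even_translate_abs W a t : continuous W -> 0 < a -> (forall y, W (- y) = W y) ->
  negative (fun x => W (x + t)) a <-> negative (fun x => W (x + `|t|)) a.
Proof.
move=> cW a0 Wev; have [t0|t0] := leP 0 t; first by rewrite ger0_norm.
rewrite ltr0_norm //; split; first exact: negative_even_translate.
by move=> /(negative_even_translate cW a0 Wev); under eq_fun do rewrite opprK.
Qed.

Lemma negative_translate_incr W a t1 t2 : continuous W -> 0 < a ->
  (forall y z, `|y| <= `|z| -> W y <= W z) -> `|t1| <= `|t2| ->
  negative (fun x => W (x + t2)) a -> negative (fun x => W (x + t1)) a.
Proof.
move=> cW a0 Wmono t12.
have Wev y : W (- y) = W y.
  by apply/eqP; rewrite eq_le !Wmono // normrN.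
rewrite (negative_even_translate_abs t2) // (negative_even_translate_abs t1) //.
have t0 := normr_ge0 t1; set s1 := `|t1| in t12 t0 *; set s2 := `|t2| in t12 *.
(* Half sum and half difference of the shifts: around the point [c] they become [b] and [- b], and
   |c - z| <= c + z gives the order that polarization requires. *)
move=> n; pose c := (s1 + s2) / 2; pose b := (s2 - s1) / 2.
have cWc : continuous (fun z => W (z + c)) by cont.
have b0 : 0 <= b by rewrite /b; lra.
have e2 : (fun x => W (x + b + c)) = (fun x => W (x + s2)).
  by apply/funext => x; congr W; rewrite /b /c; field.
have e1 : (fun x => W (x - b + c)) = (fun x => W (x + s1)).
  by apply/funext => x; congr W; rewrite /b /c; field.
have := polarization cWc a0 b0; rewrite /= e1 e2.
apply => // z z0; apply: Wmono; rewrite [leRHS]ger0_norm; last by rewrite /c; lra.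
by rewrite ler_norml /c; apply/andP; split; lra.
Qed.

Lemma negative_translate_decr W a t1 t2 : continuous W -> 0 < a ->
  (forall y z, `|y| <= `|z| -> W z <= W y) -> `|t1| <= `|t2| ->
  negative (fun x => W (x + t1)) a -> negative (fun x => W (x + t2)) a.
Proof.
move=> cW a0 Wmono t12.
have Wev y : W (- y) = W y.
  by apply/eqP; rewrite eq_le !Wmono // normrN.
rewrite (negative_even_translate_abs t2) // (negative_even_translate_abs t1) //.
have t0 := normr_ge0 t1; set s1 := `|t1| in t12 t0 *; set s2 := `|t2| in t12 *.
(* For a potential decreasing in |x| the smaller values lie on the outer side. Reflecting the shifts
   to the negative half line puts that side at - z, as polarization requires. *)
move=> /(negative_even_translate cW a0 Wev) n.
suff n2 : negative (fun x => W (x - s2)) a.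
  by have := negative_even_translate cW a0 Wev n2; under eq_fun do rewrite opprK.
pose c := (s1 + s2) / 2; pose b := (s2 - s1) / 2.
have cWc : continuous (fun z => W (z - c)) by cont.
have b0 : 0 <= b by rewrite /b; lra.
have e1 : (fun x => W (x + b - c)) = (fun x => W (x - s1)).
  by apply/funext => x; congr W; rewrite /b /c; field.
have e2 : (fun x => W (x - b - c)) = (fun x => W (x - s2)).
  by apply/funext => x; congr W; rewrite /b /c; field.
have := polarization cWc a0 b0; rewrite /= e1 e2.
apply => // z z0; apply: Wmono; rewrite -[- z - c]opprD normrN.
rewrite [leRHS]ger0_norm; last by rewrite /c; lra.
by rewrite ler_norml /c; apply/andP; split; lra.
Qed.

End Translation.

(** * Smooth approximation *)

Section Smooth.
Context {R : realType}.
Implicit Types (f g F G v w W : R -> R) (a b c x y : R).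

(** Derivatives are existential witnesses, so that sums and products go by induction on [n];
    [smooth_derivable] returns to iterated derivatives. *)
Fixpoint Ck n f : Prop :=
  if n is m.+1 then exists2 f', der f f' & Ck m f' else True.

Definition smooth f := forall n, Ck n f.

Lemma Ck_pred n f : Ck n.+1 f -> Ck n f.
Proof.
elim: n f => [//|n ih] f [f' df cf]; exists f' => //; exact: ih.
Qed.

Lemma Ck_cst n c : Ck n (fun=> c).
Proof.
elim: n c => [//|n ih] c; exists (fun=> 0); [exact: der_cst|exact: ih].
Qed.

Lemma CkD n f g : Ck n f -> Ck n g -> Ck n (fun x => f x + g x).
Proof.
elim: n f g => [//|n ih] f g [f' df cf] [g' dg cg].
by exists (fun x => f' x + g' x); [exact: derD|exact: ih].
Qed.

Lemma CkM n f g : Ck n f -> Ck n g -> Ck n (fun x => f x * g x).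
Proof.
elim: n f g => [//|n ih] f g Cf Cg; have [f' df cf] := Cf; have [g' dg cg] := Cg.
exists (fun x => f' x * g x + f x * g' x); first exact: derM.
by apply: CkD; apply: ih => //; exact: Ck_pred.
Qed.

Lemma Ck_affine n f b c : Ck n f -> Ck n (fun x => f (b * x + c)).
Proof.
elim: n f => [//|n ih] f [f' df cf].
exists (fun x => f' (b * x + c) * b); last by apply: CkM; [exact: ih|exact: Ck_cst].
apply: der_eq (der_comp df (derD (derM (der_cst b) der_id) (der_cst c))) _ => x.
by rewrite mul0r add0r addr0 mulr1.
Qed.

Lemma smooth_derivable f : smooth f -> forall n x, derivable (f^`(n))%classic x 1.
Proof.
move=> sf n; have := sf n.+1; elim: n f {sf} => [|n ih] f [f' df Cf] x.
  by rewrite derive1n0; have [] := df x.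
rewrite derive1Sn.
have -> : (f^`())%classic = f'.
  by apply/funext => z; rewrite derive1E; have [] := df z.
exact: ih.
Qed.

Lemma is_derive_sqr_bound f c : f 0 = 0 -> (forall x, `|f x| <= c * x ^+ 2) ->
  is_derive (0 : R) (1 : R) f 0.
Proof.
move=> f0 hf; apply/is_derive1_caratheodory; exists (fun z => f z / z); split.
- move=> z; rewrite f0 !subr0; have [->|z0] := eqVneq z 0; first by rewrite f0 mulr0.
  by rewrite divfK.
- have c0 : 0 <= c by have := hf 1; rewrite expr1n mulr1; apply: le_trans.
  have hb z : `|f z / z| <= c * `|z|.
    have [->|z0] := eqVneq z 0; first by rewrite f0 mul0r normr0 mulr0.
    rewrite normrM normfV ler_pdivrMr ?normr_gt0 //.
    by rewrite -mulrA -expr2 real_normK ?num_real.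
  apply/cvgrPdist_lt => e e0; apply/nbhs_ballP.
  have c1 : 0 < c + 1 by lra.
  exists (e / (c + 1)) => /=; first by rewrite divr_gt0.
  move=> z; rewrite /ball /= sub0r normrN ltr_pdivlMr // => hz.
  rewrite f0 mul0r sub0r normrN; apply: le_lt_trans (hb z) _.
  by apply: le_lt_trans hz; rewrite mulrC ler_wpM2l //; lra.
- by rewrite f0 mul0r.
Qed.

Lemma der_exprn n : der (fun x : R => x ^+ n.+1) (fun x => n.+1%:R * x ^+ n).
Proof.
elim: n => [|n ih]; first by apply: der_eq der_id _ => x; rewrite expr0 mulr1.
by apply: der_eq (derM der_id ih) _ => x /=; rewrite -(natr1 n.+1) exprS; ring.
Qed.

(** The factors x^(- n) make the family closed under differentiation, up to linear combinations;
    smoothness of exp(- 1 / x) is then an induction over the whole family. *)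
Definition flat_exp n x : R := if 0 < x then x ^- n * expR (- x^-1) else 0.

(** With m = n + 1, exp x is the m-th power of exp (x / m), which is at least x / m. *)
Lemma expr_le_expR n x : 0 <= x -> x ^+ n.+1 <= n.+1%:R ^+ n.+1 * expR x.
Proof.
move=> x0; have n0 : (0 : R) < n.+1%:R by rewrite ltr0n.
have -> : expR x = expR (x / n.+1%:R) ^+ n.+1.
  by rewrite -expRM_natr divfK // gt_eqF.
have m0 : 0 <= n.+1%:R * expR (x / n.+1%:R) by rewrite mulr_ge0 ?expR_ge0 ?ltW.
rewrite -exprMn; apply: (lerXn2r n.+1 x0 m0).
rewrite mulrC -ler_pdivrMr //; apply: le_trans (expR_ge1Dx _).
by rewrite lerDr.
Qed.

Lemma flat_exp_der n : der (flat_exp n)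
  (fun x => flat_exp n.+2 x - n%:R * flat_exp n.+1 x).
Proof.
move=> x; have [x0|x0|<-] := ltgtP 0 x.
- have xn0 : x != 0 by rewrite gt_eqF.
  have d1 : is_derive x (1 : R) (fun y => y^-1) (- x ^- 2).
    by have := @is_deriveV R id x 1 1 xn0 (is_derive_id _ _); rewrite /GRing.scale /= mulr1.
  have d2 : is_derive x (1 : R) (fun y => expR (- y^-1)) (expR (- x^-1) * x ^- 2).
    have := @is_derive1_comp R expR (fun y => - y^-1) x _ _ (is_derive_expR (- x^-1)) (is_deriveN d1).
    by rewrite opprK.
  have d3 : is_derive x (1 : R) (fun y => y^-1 ^+ n) (- (n%:R * x ^- n.+1)).
    case: (n) => [|k].
      under eq_fun do rewrite expr0; rewrite mul0r oppr0; exact: is_derive_cst.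
    apply: is_derive_eq (is_derive1_comp (der_exprn k x^-1) d1) _.
    by rewrite !exprS !invfM !exprVn expr0 invr1; ring.
  have d4 := is_deriveM d3 d2.
  apply: (@near_eq_is_derive _ _ _ ((fun y => y^-1 ^+ n) * (fun y => expR (- y^-1)))).
    near=> y; rewrite /flat_exp /GRing.mul /= exprVn.
    suff -> : 0 < y by [].
    by near: y; exact: lt_nbhsr.
  apply: is_derive_eq d4 _; rewrite /flat_exp x0 /GRing.scale /= !exprVn.
  rewrite !exprS !invfM ?expr0 ?invr1; ring.
- apply: (@near_eq_is_derive _ _ _ (fun=> 0)).
    near=> y; rewrite /flat_exp; suff y0 : y < 0 by rewrite ltNge (ltW y0).
    by near: y; exact: lt_nbhsl.
  rewrite /flat_exp ltNge (ltW x0) /= mulr0 subr0; exact: is_derive_cst.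
- rewrite /flat_exp ltxx mulr0 subr0.
  (* At 0 the bound y^(- n) exp(- 1 / y) <= c y^2 is [expr_le_expR] at 1 / y with exponent n + 2. *)
  apply: (@is_derive_sqr_bound _ (n.+2%:R ^+ n.+2)); first by rewrite ltxx.
  move=> y; case: ltP => y0; last by rewrite normr0 mulr_ge0 ?sqr_ge0 ?exprn_ge0.
  have yi0 : 0 <= y^-1 by rewrite invr_ge0 ltW.
  rewrite ger0_norm; last by rewrite mulr_ge0 ?expR_ge0 // invr_ge0 exprn_ge0 // ltW.
  rewrite expRN ler_pdivrMr ?expR_gt0 // mulrAC -ler_pdivrMr ?exprn_gt0 //.
  apply: le_trans (expr_le_expR n.+1 yi0).
  by rewrite exprVn -invfM -exprD addn2.
Unshelve. all: by end_near. Qed.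

Lemma flat_exp_smooth n : smooth (flat_exp n).
Proof.
move=> k; elim: k n => [//|k ih] n.
exists (fun x => flat_exp n.+2 x + (- n%:R) * flat_exp n.+1 x).
  by apply: der_eq (flat_exp_der n) _ => x; rewrite mulNr.
by apply: CkD => //; apply: CkM => //; exact: Ck_cst.
Qed.

Lemma smooth_continuous f : smooth f -> continuous f.
Proof. by move=> /(_ 1%N) [f' df _]; exact: der_continuous df. Qed.

Lemma smooth_prim f : smooth f -> smooth (prim f).
Proof.
by move=> sf [//|n]; exists f => //; apply: primP; exact: smooth_continuous.
Qed.

Lemma smooth_step : exists s : R -> R, [/\ smooth s, forall x, 0 <= s x <= 1,
  forall x, x <= 0 -> s x = 0 & forall x, 1 <= x -> s x = 1].
Proof.
pose b x := flat_exp 0 x * flat_exp 0 ((-1) * x + 1).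
have sb : smooth b.
  by move=> n; apply: CkM; [exact: flat_exp_smooth|apply: Ck_affine; exact: flat_exp_smooth].
have f0 x : 0 <= flat_exp 0 x.
  by rewrite /flat_exp; case: ifP => // _; rewrite expr0 invr1 mul1r expR_ge0.
have b0 x : 0 <= b x by rewrite mulr_ge0.
have bl x : x <= 0 -> b x = 0.
  by move=> x0; rewrite /b /flat_exp ltNge x0 mul0r.
have br x : 1 <= x -> b x = 0.
  move=> x1; rewrite /b {2}/flat_exp (_ : 0 < _ = false) ?mulr0 //.
  by apply/negbTE; rewrite -leNgt; lra.
have cb := smooth_continuous sb.
have dP := primP cb.
have mono x y : x <= y -> prim b x <= prim b y by move=> xy; apply: ge0_der_le dP xy _.
have pl x : x <= 0 -> prim b x = prim b 0.
  move=> x0; apply/eqP; rewrite -subr_eq0 -oppr_eq0 opprB; apply/eqP.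
  rewrite -/(intg b x 0) (@intg_eq _ _ (fun=> 0)) ?intg_cst ?mul0r //; first exact: cont_cst.
  by move=> z /andP[_ z0]; rewrite bl // ltW.
have pr x : 1 <= x -> prim b x = prim b 1.
  move=> x1; apply/eqP; rewrite -subr_eq0; apply/eqP.
  rewrite -/(intg b 1 x) (@intg_eq _ _ (fun=> 0)) ?intg_cst ?mul0r //; first exact: cont_cst.
  by move=> z /andP[z0 _]; rewrite br // ltW.
(* Without mass the monotone primitive would be constant on [0, 1], while the bump is positive at
   1/2. *)
have P0 : 0 < prim b 1 - prim b 0.
  rewrite lt_neqAle subr_ge0 mono ?ler01 // andbT eq_sym; apply/eqP => e.
  have h : is_derive (2^-1 : R) (1 : R) (prim b) 0.
    apply: (@near_eq_is_derive _ _ _ (fun=> prim b 0)).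
    near=> y.
    have /andP[y0 y1] : 0 <= y <= 1.
      have : `|2^-1 - y| < 2^-1 by near: y; apply: nbhsx_ballx; lra.
      by rewrite ltr_norml => /andP[? ?]; apply/andP; split; lra.
    by have := mono _ _ y0; have := mono _ _ y1 => h1 h2; lra.
  have := is_derive_uniq h (dP _); rewrite /b /flat_exp.
  have -> : (0 : R) < 2^-1 by lra.
  have -> : (0 : R) < -1 * 2^-1 + 1 by lra.
  by move/eqP; rewrite eq_sym gt_eqF // !expr0 invr1 !mul1r mulr_gt0 ?expR_gt0.
exists (fun x => (prim b x + (- prim b 0)) * (prim b 1 - prim b 0)^-1); split.
- move=> n; apply: CkM; last exact: Ck_cst.
  by apply: CkD; [exact: smooth_prim|exact: Ck_cst].
- move=> x; apply/andP; split.
    apply: divr_ge0; last exact: ltW.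
    rewrite subr_ge0.
    by have [/mono//|/ltW/pl->] := leP 0 x.
  rewrite ler_pdivrMr // mul1r lerD2r.
  by have [/mono//|/ltW/pr->] := leP x 1.
- by move=> x /pl ->; rewrite subrr mul0r.
- by move=> x /pr ->; rewrite divff // gt_eqF.
Unshelve. all: by end_near. Qed.

Lemma C1_lipschitz F F' x y : C1 F F' -> exists2 L, 0 < L &
  forall s t, x <= s <= y -> x <= t <= y -> `|F s - F t| <= L * `|s - t|.
Proof.
move=> [dF cF']; have [L L0 hL] := segment_bounded x y cF'.
exists L => // s t.
wlog st : s t / t <= s.
  move=> H; have [ts|/ltW st] := leP t s; first exact: H.
  by move=> h1 h2; rewrite distrC (distrC s); exact: H.
move=> /andP[xs sy] /andP[xt ty].
have cF : {within `[t, s], continuous F}.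
  by apply: continuous_subspaceT; exact: der_continuous dF.
have [c ci ->] := MVT_segment st (fun z _ => dF z) cF.
rewrite normrM ler_wpM2r // hL //; move: ci; rewrite in_itv /= => /andP[tc cs].
by rewrite (le_trans xt) //= (le_trans cs).
Qed.

(** Instead of a convolution, a staircase of smooth steps through the values of [F] at the points
    [p k]. On each step [G] is a convex combination of two neighbouring values, both within
    [L * h <= e] of [F]. *)
Lemma smooth_approx F F' a e : 0 < a -> C1 F F' -> 0 < e ->
  exists2 G, smooth G & forall x, - a <= x <= a -> `|F x - G x| <= e.
Proof.
move=> a0 CF e0; have [L L0 hL] := C1_lipschitz (- a) a CF.
have [s [ss s01 sl sr]] := smooth_step.
pose n := (Num.truncn (L * (2 * a) / e)).+1.
have n0 : (0 : R) < n%:R by rewrite ltr0n.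
pose h := 2 * a / n%:R.
have h0 : 0 < h by rewrite divr_gt0 //; lra.
have Lh : L * h <= e.
  rewrite /h mulrA ler_pdivrMr // [leRHS]mulrC -ler_pdivrMr //.
  by apply: ltW; exact: truncnS_gt.
pose p k := - a + k%:R * h.
have pn : p n = a by rewrite /p /h mulrC divfK ?gt_eqF //; ring.
have pS k : p k.+1 = p k + h by rewrite /p -natr1; ring.
have pmono k j : (k <= j)%N -> p k <= p j.
  by move=> kj; rewrite /p lerD2l ler_wpM2r ?ler_nat // ltW.
have pge k : - a <= p k by rewrite /p lerDl mulr_ge0 // ltW.
suff H k : (k <= n)%N -> exists G, [/\ smooth G, forall x, p k <= x -> G x = F (p k) &
    forall x, - a <= x <= p k -> `|F x - G x| <= e].
  by have [G [sG _ hG]] := H n (leqnn n); exists G => // x h1; apply: hG; rewrite pn.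
elim: k => [|k ih] kn.
  exists (fun=> F (p 0)); split=> [m|//|x /andP[x1 x2]]; first exact: Ck_cst.
  have -> : x = p 0 by apply/le_anti; rewrite x2 /p mul0r addr0.
  by rewrite subrr normr0 ltW.
have [G [sG Gr Gl]] := ih (ltnW kn).
exists (fun x => G x + (F (p k.+1) - F (p k)) * s (h^-1 * x + - (h^-1 * p k))); split.
- move=> m; apply: CkD => //; apply: CkM; first exact: Ck_cst.
  by apply: Ck_affine.
- move=> x px; rewrite Gr; last by apply: le_trans px; exact: pmono.
  rewrite sr ?mulr1; first by ring.
  by rewrite -mulrBr mulrC ler_pdivlMr // mul1r lerBrDr addrC -pS.
- move=> x /andP[ax xp]; rewrite -mulrBr.
  have [xpk|pkx] := leP x (p k).
    rewrite sl ?mulr0 ?addr0; first by apply: Gl; rewrite ax.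
    by rewrite pmulr_rle0 ?invr_gt0 // subr_le0.
  rewrite (Gr x (ltW pkx)).
  set t := s _; have /andP[t0 t1] := s01 (h^-1 * (x - p k)); rewrite -/t in t0 t1.
  have pi j : (j <= n)%N -> - a <= p j <= a by move=> jn; rewrite pge -pn pmono.
  have xi : - a <= x <= a by rewrite ax (le_trans xp) // -pn pmono.
  have h1 : `|F x - F (p k)| <= e.
    apply: le_trans (hL _ _ xi (pi _ (ltnW kn))) (le_trans _ Lh).
    by rewrite ler_pM2l // ger0_norm; move: xp; rewrite pS; lra.
  have h2 : `|F x - F (p k.+1)| <= e.
    apply: le_trans (hL _ _ xi (pi _ kn)) (le_trans _ Lh).
    by rewrite ler_pM2l // ler0_norm; move: xp; rewrite pS; lra.
  have -> : F x - (F (p k) + (F (p k.+1) - F (p k)) * t) =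
    (1 - t) * (F x - F (p k)) + t * (F x - F (p k.+1)) by ring.
  apply: le_trans (ler_normD _ _) _; rewrite !normrM (ger0_norm t0) ger0_norm ?subr_ge0 //.
  have t1' : 0 <= 1 - t by lra.
  have := ler_wpM2l t1' h1; have := ler_wpM2l t0 h2; lra.
Qed.

End Smooth.

(** * Reduction to the Dirichlet problem *)

Section Density.
Local Open Scope ereal_scope.
Import HBNNSimple.
Context d (T : measurableType d) (R : realType).
Variables (mu nu : {measure set T -> \bar R}) (rho : T -> R).
Hypothesis rho0 : forall x, (0 <= rho x)%R.
Hypothesis mrho : measurable_fun setT rho.
Hypothesis nuE : forall A, measurable A -> nu A = \int[mu]_(x in A) (rho x)%:E.

(** Checked on indicators, hence on simple functions; monotone convergence under both measures does
    the rest. *)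
Lemma ge0_integral_density (f : T -> \bar R) : measurable_fun setT f ->
  (forall x, 0 <= f x) -> \int[nu]_x f x = \int[mu]_x (f x * (rho x)%:E).
Proof.
move=> mf f0; pose f_ := nnsfun_approx measurableT mf.
have erho0 x : 0 <= (rho x)%:E by rewrite lee_fin.
transitivity (limn (fun n => \int[nu]_x (f_ n x)%:E)).
  rewrite -monotone_convergence//.
  - apply: eq_integral => y _; apply/esym/cvg_lim => //.
    by apply: cvg_nnsfun_approx.
  - by move=> n; exact/measurable_EFinP/measurable_funP.
  - by move=> n y _; rewrite lee_fin.
  - by move=> y _ m n mn; rewrite lee_fin; exact/lefP/nd_nnsfun_approx.
rewrite [X in limn X](_ : _ = (fun n => \int[mu]_x ((f_ n x)%:E * (rho x)%:E))).
  rewrite -monotone_convergence//.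
  - apply: eq_integral => y _; apply/cvg_lim => //.
    apply: cvgeMr => //; exact: cvg_nnsfun_approx.
  - move=> n; apply: emeasurable_funM; exact/measurable_EFinP.
  - by move=> n x _; rewrite mule_ge0 // lee_fin.
  - move=> x _ m n mn; apply: lee_wpmul2r => //.
    by rewrite lee_fin; exact/lefP/nd_nnsfun_approx.
apply/funext => n.
have mI k : measurable (f_ n @^-1` [set k]).
  by [].
transitivity (\sum_(k \in range (f_ n)) \int[nu]_x (k * \1_(f_ n @^-1` [set k]) x)%:E).
  under eq_integral do rewrite fimfunE -fsumEFin//.
  rewrite ge0_integral_fsum//.
  - by move=> y; exact/measurable_EFinP/measurable_funM.
  - by move=> y x _; rewrite nnfun_muleindic_ge0.
transitivity (\sum_(k \in range (f_ n))
    \int[mu]_x ((k * \1_(f_ n @^-1` [set k]) x)%:E * (rho x)%:E)).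
  apply: eq_fsbigr => k /set_mem [y _ yk].
  have k0 : (0 <= k)%R by rewrite -yk.
  under eq_integral do rewrite EFinM.
  rewrite ge0_integralZl_EFin //; last exact/measurable_EFinP.
  rewrite integral_indic // setIT nuE //.
  under [RHS]eq_integral do rewrite EFinM -muleA.
  rewrite ge0_integralZl_EFin //; last 2 first.
  - by move=> x _; rewrite mule_ge0 // lee_fin.
  - by apply: emeasurable_funM; exact/measurable_EFinP.
  congr (_ * _); rewrite integral_mkcond; apply: eq_integral => x _.
  by rewrite patchE indicE; case: (_ \in _); rewrite ?mul1e ?mul0e.
rewrite -ge0_integral_fsum//.
- apply: eq_integral => x _.
  rewrite (fimfunE (f_ n) x) -fsumEFin// ge0_mule_fsuml //.
  by move=> k; rewrite nnfun_muleindic_ge0.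
- move=> k; apply: emeasurable_funM; last exact/measurable_EFinP.
  exact/measurable_EFinP/measurable_funM.
- by move=> k x _; rewrite mule_ge0 // nnfun_muleindic_ge0.
Qed.

End Density.

(** * The spectral gap as a Dirichlet level *)

Section SpectralGap.
Context {R : realType}.
Variables (K : R) (N : \bar R) (h d : R).
(** [Q] is log J up to the constant log A, [k] is its derivative, and [dk] says V = k^2 / 4 - k' /
    2. The latter is asked on the open interval only, because the drifts used later are frozen
    beyond the endpoints and may have corners there. *)
Variables (k Q V : R -> R) (A : R).
Notation a := (d / 2).
Hypothesis d0 : 0 < d.
Hypothesis ck : continuous k.
Hypothesis dQ : der Q k.
Hypothesis A0 : 0 < A.
Hypothesis JE : forall x, - a <= x <= a -> J K N h x = A * expR (Q x).
Hypothesis cV : continuous V.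
Hypothesis dk : forall x, - a < x < a -> is_derive x (1 : R) k (k x ^+ 2 / 2 - 2 * V x).

Let rho x := expR (Q x).
Let xi : {measure set (measurableTypeR R) -> \bar R} := Jmeasure K N h d.

Let a0 : 0 < a. Proof. by rewrite divr_gt0. Qed.
Let aa : - a <= a. Proof. by have := a0; lra. Qed.
Let cQ : continuous Q := der_continuous dQ.
Let crho : continuous rho. Proof. by rewrite /rho; cont. Qed.

Lemma ge0_integral_Jmeasure (F : R -> R) : continuous F -> (forall x, 0 <= F x) ->
  (\int[xi]_x (F x)%:E = (A * intg (fun x => F x * rho x) (- a) a)%:E)%E.
Proof.
move=> cF F0.
rewrite (ge0_integral_density (mu := lebesgue_measure) (rho := Jcut K N h d)) //.
- have aa' : - a < a by have := a0; lra.
  have cFr : continuous (fun x => A * (F x * rho x)) by cont.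
  rewrite -intgZ; last by cont.
  rewrite -intg_lebesgue // [RHS]integral_mkcond; apply: eq_integral => x _.
  rewrite patchE /Jcut indicE mulrA; case: ifPn => xa.
    rewrite mulr1 -EFinM JE; first by congr (_%:E); rewrite /rho; ring.
    by move: xa; rewrite inE /= in_itv.
  by rewrite mulr0 mule0.
- by move=> x; exact: Jcut_ge0.
- exact: measurable_Jcut.
- by apply/measurable_EFinP; exact: continuous_measurable_fun.
Qed.

Lemma integral_Jmeasure (F : R -> R) : continuous F ->
  (\int[xi]_x (F x)%:E = (A * intg (fun x => F x * rho x) (- a) a)%:E)%E.
Proof.
move=> cF.
have cP : continuous (fun x => Num.max (F x) 0) by cont.
have cM : continuous (fun x => Num.max (- F x) 0) by cont.
rewrite integralE.
have -> : (\int[xi]_x ((fun x => (F x)%:E)^\+ x) = \int[xi]_x (Num.max (F x) 0)%:E)%E.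
  by apply: eq_integral => x _; rewrite funeposE EFin_max.
have -> : (\int[xi]_x ((fun x => (F x)%:E)^\- x) = \int[xi]_x (Num.max (- F x) 0)%:E)%E.
  by apply: eq_integral => x _; rewrite funenegE EFin_max EFinN.
rewrite !ge0_integral_Jmeasure //; try by move=> x; rewrite le_max lexx orbT.
rewrite -EFinB -mulrBr -intgB; [|by cont|by cont].
congr (_ * _)%:E; apply: intg_eq => //; [by cont|by cont|].
move=> x _; rewrite -mulrBl; congr (_ * _).
have [F0|F0] := leP 0 (F x).
  by rewrite max_r ?subr0 // oppr_le0.
by rewrite max_l ?sub0r ?opprK // oppr_ge0 (ltW F0).
Qed.

Lemma rayleigh_Jmeasure F F' : C1 F F' ->
  let D := intg (fun x => F x ^+ 2 * rho x) (- a) a in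
  rayleigh xi F = (if (D == 0)%R then +oo
    else (intg (fun x => F' x ^+ 2 * rho x) (- a) a / D)%:E)%E.
Proof.
move=> [dF cF'] D; have cF := der_continuous dF.
have F'E : (F^`())%classic = F'.
  by apply/funext => x; rewrite derive1E; have [] := dF x.
rewrite /rayleigh F'E ge0_integral_Jmeasure; [|by cont|by move=> x; exact: sqr_ge0].
rewrite ge0_integral_Jmeasure; [|by cont|by move=> x; exact: sqr_ge0].
rewrite -/D; have [->|D_neq0] := eqVneq D 0; first by rewrite mulr0 eqxx.
have AD : A * D != 0 by rewrite mulf_neq0 // gt_eqF.
rewrite eqe (negbTE AD) inver (negbTE AD) -EFinM; congr (_%:E).
by field; rewrite D_neq0 gt_eqF.
Qed.

(** By the Riccati relation [dk] the integrands differ by the derivative of k v^2 / 2, which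
    vanishes at both ends. *)
Lemma intg_potential v v' : C1 v v' -> v (- a) = 0 -> v a = 0 ->
  intg (fun x => (v' x + k x * v x / 2) ^+ 2) (- a) a =
  intg (fun x => v' x ^+ 2 + V x * v x ^+ 2) (- a) a.
Proof.
move=> [dv cv'] vNa va; have cv := der_continuous dv.
have dG z : - a < z < a -> is_derive z (1 : R) (fun x => k x * (v x * v x) / 2)
    ((v' z + k z * v z / 2) ^+ 2 - (v' z ^+ 2 + V z * v z ^+ 2)).
  move=> /dk dkz.
  have D := is_derive_mul (is_derive_mul dkz (derM dv dv z)) (der_cst 2^-1 z).
  by apply: is_derive_eq D _; field.
have c1 : continuous (fun x => (v' x + k x * v x / 2) ^+ 2) by cont.
have c2 : continuous (fun x => v' x ^+ 2 + V x * v x ^+ 2) by cont.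
have := intgB (- a) a c1 c2; rewrite (intgE_oo aa _ _ dG); [|by cont|by cont].
by rewrite vNa va !mulr0 mul0r; lra.
Qed.

Lemma intg_rho_gt0 : 0 < intg rho (- a) a.
Proof.
have [M M0 hM] := segment_bounded (- a) a cQ.
apply: (@lt_le_trans _ _ (intg (fun=> expR (- M)) (- a) a)).
  by rewrite intg_cst mulr_gt0 ?expR_gt0 //; have := a0; lra.
apply: intg_le => //; first exact: cont_cst.
move=> z /andP[z1 z2]; rewrite /rho ler_expR.
have zi : - a <= z <= a by rewrite !ltW.
by have := hM z zi; rewrite ler_norml => /andP[].
Qed.

(** The mean zero condition makes [g] vanish at both ends. For v = g rho^(-1/2) one has v' + k v / 2
    = F rho^(1/2), so the energy of [v] at level [r] is D - r P. Parts and Cauchy-Schwarz give D^2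
    <= E P < r D P, hence D < r P. *)
Lemma negative_of_test F F' r : C1 F F' ->
  intg (fun x => F x * rho x) (- a) a = 0 ->
  0 < intg (fun x => F x ^+ 2 * rho x) (- a) a ->
  intg (fun x => F' x ^+ 2 * rho x) (- a) a <
    r * intg (fun x => F x ^+ 2 * rho x) (- a) a ->
  negative (fun x => V x - r) a.
Proof.
move=> CF mean; set D := intg _ _ _; set E := intg _ _ _ => D0 ED.
have [dF cF'] := CF; have cF := der_continuous dF.
have cFr : continuous (fun x => F x * rho x) by cont.
pose g x := prim (fun x => F x * rho x) x - prim (fun x => F x * rho x) (- a).
have dg : der g (fun x => F x * rho x).
  by apply: der_eq (derB (primP cFr) (der_cst _)) _ => x; rewrite subr0.
have cg := der_continuous dg.
have gNa : g (- a) = 0 by rewrite /g subrr.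
have ga : g a = 0 by [].
pose u x := expR (- Q x / 2).
have du : der u (fun x => - (k x / 2) * u x).
  apply: der_eq (der_comp der_expR (derM (derN dQ) (der_cst 2^-1))) _ => x.
  by rewrite /u /=; ring.
have cu := der_continuous du.
have uu x : u x ^+ 2 * rho x = 1.
  by rewrite /u /rho expr2 -!expRD (_ : _ + _ = 0) ?expR0 //; field.
pose v x := g x * u x; pose v' x := F x * rho x * u x + g x * (- (k x / 2) * u x).
have Cv : C1 v v' by split; [exact: derM|rewrite /v'; cont].
have cv := der_continuous Cv.1.
have vNa : v (- a) = 0 by rewrite /v gNa mul0r.
have va : v a = 0 by rewrite /v ga mul0r.
have cW : continuous (fun x => V x - r) by cont.
apply: (negative_of_C1 a0 cW Cv vNa va).
pose P := intg (fun x => v x ^+ 2) (- a) a.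
have -> : intg (fun x => v' x ^+ 2 + (V x - r) * v x ^+ 2) (- a) a = D - r * P.
  rewrite /P -intgZ; last by cont.
  have -> : D = intg (fun x => v' x ^+ 2 + V x * v x ^+ 2) (- a) a.
    rewrite -intg_potential // /D; congr intg; apply/funext => x.
    rewrite (_ : v' x + _ = F x * rho x * u x); last by rewrite /v' /v; field.
    rewrite -[LHS]mulr1 -(uu x); ring.
  rewrite -intgB; [|exact: cont_energy|by cont].
  by congr intg; apply/funext => x; ring.
have DE : D = - intg (fun x => F' x * g x) (- a) a.
  have := intg_by_parts (- a) a dF dg cF' cFr; rewrite gNa ga !mulr0 subrr sub0r => <-.
  by rewrite /D; congr intg; apply/funext => x; ring.
have CS : D ^+ 2 <= E * P.
  have cru : continuous (fun x => F' x * (rho x * u x)) by cont.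
  have := cauchy_schwarz cru cv aa; rewrite -/P.
  rewrite (_ : intg (fun x => F' x * (rho x * u x) * v x) (- a) a = - D); last first.
    rewrite DE opprK; congr intg; apply/funext => x; rewrite /v.
    rewrite -[RHS]mulr1 -(uu x); ring.
  rewrite sqrrN (_ : intg (fun x => (F' x * (rho x * u x)) ^+ 2) (- a) a = E) //.
  rewrite /E; congr intg; apply/funext => x.
  rewrite -[RHS]mulr1 -(uu x); ring.
have P0 : 0 <= P by apply: intg_ge0 => //; [by cont|move=> z _; exact: sqr_ge0].
have D2 : 0 < D ^+ 2 by rewrite exprn_gt0.
have Pp : 0 < P by rewrite lt_neqAle P0 andbT; apply/eqP => e; move: CS; rewrite -e mulr0; lra.
rewrite -(pmulr_rlt0 _ D0).
have := ltr_pM2r Pp E (r * D); rewrite ED => /idP; lra.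
Qed.

(** The mirror argument: now P is the Dirichlet integral of [f] and E the energy of [v], and P^2 <=
    D E < r D P gives P < r D. The second derivative [f2] is recorded because [smooth_test]
    approximates [f1]. *)
Lemma test_of_negative r : negative (fun x => V x - r) a ->
  exists f f1 f2 : R -> R, [/\ C1 f f1, C1 f1 f2,
    intg (fun x => f x * rho x) (- a) a = 0 &
    intg (fun x => f1 x ^+ 2 * rho x) (- a) a <
    r * intg (fun x => f x ^+ 2 * rho x) (- a) a].
Proof.
move=> [v [v' [Cv _ vz I]]].
have [dv cv'] := Cv; have cv := der_continuous dv.
have vNa : v (- a) = 0 by apply: vz; rewrite normrN ler_norm.
have va : v a = 0 by apply: vz; rewrite ler_norm.
pose P := intg (fun x => v x ^+ 2) (- a) a.
pose E := intg (fun x => (v' x + k x * v x / 2) ^+ 2) (- a) a.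
have EP : E < r * P.
  rewrite -subr_lt0; apply: le_lt_trans I; rewrite /E intg_potential // /P -intgZ; last by cont.
  rewrite -intgB; [|exact: cont_energy|by cont].
  by rewrite le_eqVlt; apply/orP; left; apply/eqP; congr intg; apply/funext => x; ring.
have E0 : 0 <= E by apply: intg_ge0 => //; [by cont|move=> z _; exact: sqr_ge0].
have P0 : 0 <= P by apply: intg_ge0 => //; [by cont|move=> z _; exact: sqr_ge0].
have Pp : 0 < P by rewrite lt_neqAle P0 andbT; apply/eqP => e; move: EP; rewrite -e mulr0; lra.
pose u x := expR (- Q x / 2).
have du : der u (fun x => - (k x / 2) * u x).
  apply: der_eq (der_comp der_expR (derM (derN dQ) (der_cst 2^-1))) _ => x.
  by rewrite /u /=; ring.
have cu := der_continuous du.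
have uu x : u x ^+ 2 * rho x = 1.
  by rewrite /u /rho expr2 -!expRD (_ : _ + _ = 0) ?expR0 //; field.
pose f1 x := - (v x * u x).
have Cf1 : C1 f1 (fun x => - (v' x * u x + v x * (- (k x / 2) * u x))).
  by split; [exact: derN (derM dv du)|cont].
have cf1 := der_continuous Cf1.1.
have irho := intg_rho_gt0.
have cp := der_continuous (primP cf1).
pose c := intg (fun x => prim f1 x * rho x) (- a) a / intg rho (- a) a.
pose f x := prim f1 x - c.
have Cf : C1 f f1.
  by split => //; apply: der_eq (derB (primP cf1) (der_cst c)) _ => x; rewrite subr0.
have cf := der_continuous Cf.1.
exists f, f1, (fun x => - (v' x * u x + v x * (- (k x / 2) * u x))); split=> //.
  rewrite /f (_ : (fun x => _) = (fun x => prim f1 x * rho x - c * rho x)).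
    by rewrite intgB ?intgZ ?divfK ?subrr // ?gt_eqF //; cont.
  by apply/funext => x; rewrite mulrBl.
set D := intg (fun x => f x ^+ 2 * rho x) _ _.
have -> : intg (fun x => f1 x ^+ 2 * rho x) (- a) a = P.
  rewrite /P; congr intg; apply/funext => x; rewrite /f1.
  by rewrite -[RHS]mulr1 -(uu x); ring.
(* [w] is the square root of rho, and (v w)' = w (v' + k v / 2). *)
pose w x := rho x * u x.
have dw : der w (fun x => k x / 2 * w x).
  apply: der_eq (derM (der_comp der_expR dQ) du) _ => x.
  by rewrite /w /rho; field.
have cw := der_continuous dw.
have dvw := derM dv dw.
have cdvw : continuous (fun x => v' x * w x + v x * (k x / 2 * w x)) by cont.
have PE : P = intg (fun x => f x * w x * (v' x + k x * v x / 2)) (- a) a.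
  have := intg_by_parts (- a) a Cf.1 dvw cf1 cdvw.
  rewrite vNa va !mul0r !mulr0 subrr sub0r => e.
  rewrite (_ : (fun x => _) = (fun x => f x * (v' x * w x + v x * (k x / 2 * w x)))); last first.
    by apply/funext => x; field.
  rewrite e -mulN1r -intgZ; last by cont.
  rewrite /P; congr intg; apply/funext => x; rewrite /f1 /w.
  by rewrite mulN1r -[LHS]mulr1 -(uu x); ring.
have CS : P ^+ 2 <= D * E.
  have cfw : continuous (fun x => f x * w x) by cont.
  have cE : continuous (fun x => v' x + k x * v x / 2) by cont.
  have := cauchy_schwarz cfw cE aa; rewrite -PE -/E.
  rewrite (_ : intg (fun x => (f x * w x) ^+ 2) (- a) a = D) //.
  rewrite /D; congr intg; apply/funext => x; rewrite /w.
  by rewrite -[RHS]mulr1 -(uu x); ring.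
have D0 : 0 <= D.
  apply: intg_ge0 => //; first by cont.
  by move=> z _; rewrite mulr_ge0 ?sqr_ge0 ?expR_ge0.
have P2 : 0 < P ^+ 2 by rewrite exprn_gt0.
have Dp : 0 < D by rewrite lt_neqAle D0 andbT; apply/eqP => e; move: CS; rewrite -e mul0r; lra.
rewrite -(ltr_pM2l Pp) -expr2; apply: le_lt_trans CS _.
by rewrite (_ : P * (r * D) = D * (r * P)) ?ltr_pM2l //; ring.
Qed.

(** The derivative is approximated and then integrated, which controls the function as well;
    subtracting a constant restores the mean. *)
Lemma smooth_test f f1 f2 r : C1 f f1 -> C1 f1 f2 ->
  intg (fun x => f x * rho x) (- a) a = 0 ->
  intg (fun x => f1 x ^+ 2 * rho x) (- a) a <
    r * intg (fun x => f x ^+ 2 * rho x) (- a) a ->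
  exists F F1 : R -> R, [/\ smooth F, C1 F F1,
    intg (fun x => F x * rho x) (- a) a = 0 &
    intg (fun x => F1 x ^+ 2 * rho x) (- a) a <
    r * intg (fun x => F x ^+ 2 * rho x) (- a) a].
Proof.
move=> Cf Cf1 mean I0.
have cf := der_continuous Cf.1; have cf1 := der_continuous Cf1.1.
have [M M0 hM] := segment_bounded (- a) a cf.
have [M1 M10 hM1] := segment_bounded (- a) a cf1.
have [B B0 hB] := segment_bounded (- a) a crho.
(* [T] bounds f, f1 and their approximations, as |G - f1| <= e1 <= 1 and |F - f| <= 4 a e1. The two
   terms of [C] are the [sqr_perturb_norm] errors of the numerator and of [r] times the
   denominator. *)
pose T := M + M1 + 1 + 4 * a.
have T0 : 0 < T by rewrite /T; have := a0; lra.
pose C := 2 * B * T + 2 * (`|r| * B) * T * (4 * a).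
have C0 : 0 <= C.
  by rewrite /C addr_ge0 // !mulr_ge0 // ?normr_ge0 // ?ltW //; have := a0; lra.
rewrite -subr_lt0 in I0.
have C20 : 0 <= C * (a - - a) by rewrite mulr_ge0 //; have := aa; lra.
have [e e0 he] := small_slope I0 C20.
pose e1 := Num.min e 1.
have e10 : 0 < e1 by rewrite lt_min e0 ltr01.
have e11 : e1 <= 1 by rewrite ge_min lexx orbT.
have he1 : intg (fun x => f1 x ^+ 2 * rho x) (- a) a -
    r * intg (fun x => f x ^+ 2 * rho x) (- a) a + C * (a - - a) * e1 < 0.
  by apply: le_lt_trans he; rewrite lerD2l ler_wpM2l // ge_min lexx.
have [G sG hG] := smooth_approx a0 Cf1 e10.
have cG := smooth_continuous sG; have dP := primP cG; have cP := der_continuous dP.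
pose p x := prim G x + (f (- a) - prim G (- a)).
have dp : der p G by apply: der_eq (derD dP (der_cst _)) _ => x; rewrite addr0.
have cp := der_continuous dp.
have pf x : - a <= x <= a -> `|p x - f x| <= 2 * a * e1.
  move=> /andP[x1 x2].
  have -> : p x - f x = intg (fun z => G z - f1 z) (- a) x.
    rewrite intgB // (intgE _ _ Cf.1) // (intgE _ _ dP) // /p; ring.
  have cGf : continuous (fun z => G z - f1 z) by cont.
  have hGf z : - a < z < x -> - e1 <= G z - f1 z <= e1.
    move=> /andP[z1 z2]; rewrite -ler_norml distrC; apply: hG.
    by rewrite (ltW z1) (le_trans (ltW z2)).
  have xa : e1 * (x - - a) <= 2 * a * e1 by have := ler_wpM2l (ltW e10) x2; lra.
  rewrite ler_norml; apply/andP; split.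
    apply: (@le_trans _ _ (intg (fun=> - e1) (- a) x)); first by rewrite intg_cst; lra.
    by apply: intg_le => //; [exact: cont_cst|move=> z /hGf /andP[]].
  apply: (@le_trans _ _ (intg (fun=> e1) (- a) x)); last by rewrite intg_cst.
  by apply: intg_le => //; [exact: cont_cst|move=> z /hGf /andP[]].
have i0 := intg_rho_gt0.
pose c := intg (fun x => p x * rho x) (- a) a / intg rho (- a) a.
have hc : `|c| <= 2 * a * e1.
  rewrite normrM normfV (ger0_norm (ltW i0)) ler_pdivrMr //.
  have -> : intg (fun x => p x * rho x) (- a) a = intg (fun x => (p x - f x) * rho x) (- a) a.
    rewrite -[LHS]subr0 -mean -intgB; [|by cont|by cont].
    by congr intg; apply/funext => x; ring.
  have cpf : continuous (fun x => (p x - f x) * rho x) by cont.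
  have hpf z : - a < z < a -> - (2 * a * e1) * rho z <= (p z - f z) * rho z <= 2 * a * e1 * rho z.
    move=> /andP[z1 z2]; have := pf z; rewrite (ltW z1) (ltW z2) => /(_ isT).
    by rewrite ler_norml => /andP[p1 p2]; rewrite !ler_pM2r ?expR_gt0 // p1.
  rewrite ler_norml -mulNr -!intgZ //; apply/andP; split.
    by apply: intg_le => //; [by cont|move=> z /hpf /andP[]].
  by apply: intg_le => //; [by cont|move=> z /hpf /andP[]].
pose F x := p x - c.
have dF : der F G by apply: der_eq (derB dp (der_cst c)) _ => x; rewrite subr0.
have cF := der_continuous dF.
exists F, G; split=> //.
- move=> n; rewrite /F /p; do 2 (apply: CkD; last exact: Ck_cst).
  exact: smooth_prim.
- rewrite /F (_ : (fun x => _) = (fun x => p x * rho x - c * rho x)).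
    by rewrite intgB ?intgZ ?divfK ?subrr // ?gt_eqF //; cont.
  by apply/funext => x; rewrite mulrBl.
rewrite -subr_lt0; apply: le_lt_trans he1.
rewrite (_ : C * (a - - a) * e1 = C * e1 * (a - - a)); last by ring.
rewrite -!intgZ; [|by cont|by cont].
rewrite -intgB; [|by cont|by cont].
rewrite -intgB; [|by cont|by cont].
rewrite -intg_cst -intgD; [|by cont|exact: cont_cst].
have c1 : continuous (fun z => f1 z ^+ 2 * rho z - r * (f z ^+ 2 * rho z) + C * e1) by cont.
apply: intg_le => //; first by cont.
move=> z /andP[z1 z2]; have zi : - a <= z <= a by rewrite (ltW z1) (ltW z2).
have a0' := a0.
have ae : a * e1 <= a by rewrite ler_piMr // ltW.
have Fz : `|F z - f z| <= 4 * a * e1.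
  have := ler_normB (p z - f z) c; rewrite /F addrAC; have := pf z zi; lra.
have h1 : rho z * G z ^+ 2 <= rho z * f1 z ^+ 2 + 2 * B * T * e1.
  have Gf : `|G z - f1 z| <= e1 by rewrite distrC hG.
  apply: sqr_perturb_norm => //; [exact: hB| |].
    have := ler_normD (G z - f1 z) (f1 z); rewrite subrK; have := hM1 z zi; rewrite /T; lra.
  have := hM1 z zi; rewrite /T; lra.
have h2 : - r * rho z * F z ^+ 2 <= - r * rho z * f z ^+ 2 + 2 * (`|r| * B) * T * (4 * a * e1).
  apply: sqr_perturb_norm => //.
  - by rewrite normrM normrN ler_wpM2l // hB.
  - have := ler_normD (F z - f z) (f z); rewrite subrK; have := hM z zi; rewrite /T; lra.
  - have := hM z zi; rewrite /T; lra.
rewrite /C; lra.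
Qed.

Lemma lambda_lt_negative r : (lambda K N h d < r%:E)%E -> negative (fun x => V x - r) a.
Proof.
move=> /ereal_inf_lt [_ [F [sF _ mean] <-]].
have d1 n x : derivable (F^`(n))%classic x 1 by case: sF.
pose F' := (F^`())%classic.
have CF : C1 F F'.
  split.
    move=> x; rewrite /F' derive1E; apply: derivableP; exact: (d1 0%N).
  move=> x; apply: differentiable_continuous; apply/derivable1_diffP.
  by have := d1 1%N x; rewrite derive1n1.
have cF := der_continuous CF.1; have cF' := CF.2.
rewrite (rayleigh_Jmeasure CF); case: ifPn => // D_neq0; rewrite lte_fin => hr.
move: mean; rewrite integral_Jmeasure // => -[/eqP].
rewrite mulf_eq0 gt_eqF //= => /eqP mean.
have D0 : 0 < intg (fun x => F x ^+ 2 * rho x) (- a) a.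
  rewrite lt_neqAle eq_sym D_neq0 /=; apply: intg_ge0 => //; first by cont.
  by move=> z _; rewrite mulr_ge0 ?sqr_ge0 ?expR_ge0.
apply: (negative_of_test CF mean D0).
by rewrite -ltr_pdivrMr.
Qed.

Lemma negative_lambda_le r : negative (fun x => V x - r) a -> (lambda K N h d <= r%:E)%E.
Proof.
move=> /test_of_negative [f [f1 [f2 [Cf Cf1 mean0 I0]]]].
have [F [F1 [sF CF mean I]]] := smooth_test Cf Cf1 mean0 I0.
have [s [ss s01 sl sr]] := @smooth_step R.
(* No boundary condition is imposed at - a and a, so compact support is obtained by a cutoff outside
   the interval, equal to 1 on [- a, a] and 0 beyond a + 1. *)
pose T x := F x * (s (1 * x + (a + 1)) * s (-1 * x + (a + 1))).
have sT : smooth T.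
  by move=> n; apply: CkM => //; apply: CkM; apply: Ck_affine.
have [T1 dT [T2 dT1 _]] := sT 2%N.
have cT1 := der_continuous dT1.
have CT : C1 T T1 by [].
have TF x : - a <= x <= a -> T x = F x.
  by move=> /andP[x1 x2]; rewrite /T !sr ?mulr1 //; lra.
have T1F := C1_eq_deriv CF CT TF.
have TF' x : - a < x < a -> T x = F x by move=> /andP[x1 x2]; rewrite TF // !ltW.
have cT := der_continuous dT; have cF := der_continuous CF.1; have cF1 := CF.2.
have eD : intg (fun x => T x ^+ 2 * rho x) (- a) a = intg (fun x => F x ^+ 2 * rho x) (- a) a.
  by apply: intg_eq => //; [by cont|by cont|move=> z /TF' ->].
have eN : intg (fun x => T1 x ^+ 2 * rho x) (- a) a = intg (fun x => F1 x ^+ 2 * rho x) (- a) a.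
  by apply: intg_eq => //; [by cont|by cont|move=> z /T1F ->].
have em : intg (fun x => T x * rho x) (- a) a = 0.
  by rewrite -mean; apply: intg_eq => //; [by cont|by cont|move=> z /TF' ->].
have D0 : 0 <= intg (fun x => F x ^+ 2 * rho x) (- a) a.
  apply: intg_ge0 => //; first by cont.
  by move=> z _; rewrite mulr_ge0 ?sqr_ge0 ?expR_ge0.
have N0 : 0 <= intg (fun x => F1 x ^+ 2 * rho x) (- a) a.
  apply: intg_ge0 => //; first by cont.
  by move=> z _; rewrite mulr_ge0 ?sqr_ge0 ?expR_ge0.
have D_neq0 : intg (fun x => F x ^+ 2 * rho x) (- a) a != 0.
  by apply/eqP => e; move: I; rewrite e mulr0; lra.
have Dp : 0 < intg (fun x => F x ^+ 2 * rho x) (- a) a by rewrite lt_neqAle eq_sym D_neq0.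
apply: (@le_trans _ _ (rayleigh xi T)); last first.
  rewrite (rayleigh_Jmeasure CT) eD eN (negbTE D_neq0) lee_fin.
  by rewrite ler_pdivrMr // ltW.
apply: ereal_inf_lbound; exists T => //; split.
- split; first exact: smooth_derivable.
  apply: (@subclosed_compact _ _ `[- (a + 1), a + 1]); first exact: closed_closure.
    exact: segment_compact.
  rewrite [X in _ `<=` X](closure_id _).1; last exact: interval_closed.
  apply: closure_subset => x /= Tx; rewrite in_itv /=; apply/andP; split.
    rewrite leNgt; apply/negP => hx; move/eqP: Tx; apply.
    by rewrite /T (sl (1 * x + _)) ?mul0r ?mulr0 //; lra.
  rewrite leNgt; apply/negP => hx; move/eqP: Tx; apply.
  by rewrite /T (sl (-1 * x + _)) ?mulr0 //; lra.
- apply: contrapT => nT; move/eqP: D_neq0; apply; rewrite -eD.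
  rewrite (_ : (fun x => _) = (fun=> 0)) ?intg_cst ?mul0r //; apply/funext => x.
  suff -> : T x = 0 by rewrite expr0n mul0r.
  by apply: contrapT => Tx; apply: nT; exists x; apply/eqP.
- by rewrite integral_Jmeasure // em mulr0.
Qed.

End SpectralGap.

(** * The model densities *)

Local Notation sfun := Defs.sfun.

Section ModelFunctions.
Context {R : realType}.
Implicit Types t x y z eta : R.

(** With r the square root of |t|, identities in [t] become trigonometric or hyperbolic identities
    in r. *)
Lemma cfun_sfun_elim (P : (R -> R) -> (R -> R) -> R -> Prop) :
  (forall r, 0 < r -> P (fun x => cos (r * x)) (fun x => sin (r * x) / r) (r ^+ 2)) ->
  P (fun=> 1) (fun x => x) 0 ->
  (forall r, 0 < r -> P (fun x => cosh (r * x)) (fun x => sinh (r * x) / r) (- r ^+ 2)) ->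
  forall t, P (cfun t) (sfun t) t.
Proof.
move=> Pp P0 Pn t; have [t0|t0|->] := ltgtP t 0.
- have e : t = - Num.sqrt (- t) ^+ 2 by rewrite sqr_sqrtr ?opprK // oppr_ge0 ltW.
  have -> : cfun t = fun x => cosh (Num.sqrt (- t) * x).
    by apply/funext => x; rewrite /cfun ltNge (ltW t0) /= lt_eqF.
  have -> : sfun t = fun x => sinh (Num.sqrt (- t) * x) / Num.sqrt (- t).
    by apply/funext => x; rewrite /sfun ltNge (ltW t0) /= lt_eqF.
  by rewrite [X in P _ _ X]e; apply: Pn; rewrite sqrtr_gt0 oppr_gt0.
- have e : t = Num.sqrt t ^+ 2 by rewrite sqr_sqrtr // ltW.
  have -> : cfun t = fun x => cos (Num.sqrt t * x).
    by apply/funext => x; rewrite /cfun t0.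
  have -> : sfun t = fun x => sin (Num.sqrt t * x) / Num.sqrt t.
    by apply/funext => x; rewrite /sfun t0.
  by rewrite [X in P _ _ X]e; apply: Pp; rewrite sqrtr_gt0.
- have -> : cfun 0 = (fun=> 1) :> (R -> R).
    by apply/funext => x; rewrite /cfun ltxx eqxx.
  have -> // : sfun 0 = (fun x => x) :> (R -> R).
  by apply/funext => x; rewrite /sfun ltxx eqxx.
Qed.

Lemma coshD x y : cosh (x + y) = cosh x * cosh y + sinh x * sinh y.
Proof. by rewrite /cosh /sinh opprD !expRD; field. Qed.

Lemma sinhD x y : sinh (x + y) = sinh x * cosh y + cosh x * sinh y.
Proof. by rewrite /cosh /sinh opprD !expRD; field. Qed.

Lemma coshN x : cosh (- x) = cosh x.
Proof. by rewrite /cosh opprK addrC. Qed.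

Lemma sinhN x : sinh (- x) = - sinh x.
Proof. by rewrite /sinh opprK -mulNr opprB. Qed.

Lemma cosh_gt0 x : 0 < cosh x.
Proof. by rewrite divr_gt0 // addr_gt0 // expR_gt0. Qed.

Lemma der_cosh : der (@cosh R) sinh.
Proof.
apply: der_eq (derM (derD der_expR (der_comp der_expR (derN der_id))) (der_cst 2^-1)) _.
by move=> x /=; rewrite /sinh; ring.
Qed.

Lemma der_sinh : der (@sinh R) cosh.
Proof.
apply: der_eq (derM (derB der_expR (der_comp der_expR (derN der_id))) (der_cst 2^-1)) _.
by move=> x /=; rewrite /cosh; ring.
Qed.

Lemma der_scale (f f' : R -> R) r : der f f' -> der (fun x => f (r * x)) (fun x => f' (r * x) * r).
Proof.
move=> df; apply: der_eq (der_comp df (derM (der_cst r) der_id)) _ => x /=.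
by rewrite mul0r add0r mulr1.
Qed.

Lemma der_cfun t : der (cfun t) (fun x => - t * sfun t x).
Proof.
move: t; apply: (cfun_sfun_elim (P := fun c s t => der c (fun x => - t * s x))).
- move=> r r0; have dc : der (@cos R) (fun x => - sin x) by move=> x; exact: is_derive_cos.
  by apply: der_eq (der_scale r dc) _ => x; field; rewrite gt_eqF.
- by apply: der_eq (der_cst 1) _ => x; rewrite oppr0 mul0r.
- by move=> r r0; apply: der_eq (der_scale r der_cosh) _ => x; field; rewrite gt_eqF.
Qed.

Lemma der_sfun t : der (sfun t) (cfun t).
Proof.
move: t; apply: (cfun_sfun_elim (P := fun c s t => der s c)).
- move=> r r0; have ds : der (@sin R) cos by move=> x; exact: is_derive_sin.
  by apply: der_eq (derM (der_scale r ds) (der_cst r^-1)) _ => x; field; rewrite gt_eqF.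
- exact: der_id.
- by move=> r r0; apply: der_eq (derM (der_scale r der_sinh) (der_cst r^-1)) _ => x; field; rewrite gt_eqF.
Qed.

Lemma cfunN t x : cfun t (- x) = cfun t x.
Proof.
move: t; apply: (cfun_sfun_elim (P := fun c s t => c (- x) = c x)) => // r _.
  by rewrite mulrN cosN.
by rewrite mulrN coshN.
Qed.

Lemma sfunN t x : sfun t (- x) = - sfun t x.
Proof.
move: t; apply: (cfun_sfun_elim (P := fun c s t => s (- x) = - s x)) => // r _.
  by rewrite mulrN sinN mulNr.
by rewrite mulrN sinhN mulNr.
Qed.

Lemma cfunB t x y : cfun t (x - y) = cfun t x * cfun t y + t * sfun t x * sfun t y.
Proof.
move: t; apply: (cfun_sfun_elim (P := fun c s t => c (x - y) = c x * c y + t * s x * s y)) => [r r0||r r0].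
- by rewrite mulrBr cosB; field; rewrite gt_eqF.
- by ring.
- by rewrite mulrBr coshD coshN sinhN; field; rewrite gt_eqF.
Qed.

Lemma sfunB t x y : sfun t (x - y) = sfun t x * cfun t y - cfun t x * sfun t y.
Proof.
move: t; apply: (cfun_sfun_elim (P := fun c s t => s (x - y) = s x * c y - c x * s y)) => [r r0||r r0].
- by rewrite mulrBr sinB; field; rewrite gt_eqF.
- by ring.
- by rewrite mulrBr sinhD coshN sinhN; field; rewrite gt_eqF.
Qed.

Lemma cfun0 t : cfun t 0 = 1.
Proof.
move: t; apply: (cfun_sfun_elim (P := fun c s t => c 0 = 1)) => // r _; rewrite mulr0.
  exact: cos0.
by rewrite /cosh oppr0 expR0; field.
Qed.

Lemma sfun0 t : sfun t 0 = 0.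
Proof. by have := sfunN t 0; rewrite oppr0; lra. Qed.

Lemma cfun2_sfun2 t x : cfun t x ^+ 2 + t * sfun t x ^+ 2 = 1.
Proof. by have := cfunB t x x; rewrite subrr cfun0 => ->; ring. Qed.

Lemma cfun_gt0 t x : t <= 0 -> 0 < cfun t x.
Proof.
move: t; apply: (cfun_sfun_elim (P := fun c s t => t <= 0 -> 0 < c x)) => // r r0.
  have r2 : 0 < r ^+ 2 by rewrite exprn_gt0.
  by lra.
by move=> _; exact: cosh_gt0.
Qed.

(* By the addition formula, the equation for [x0] makes [cfun t + eta sfun t] a
   multiple of the translate of [cfun t] by [x0]. *)
Lemma center_exists t eta : 0 < t \/ eta ^+ 2 + t < 0 ->
  exists2 x0, t * sfun t x0 = eta * cfun t x0 & forall y, `|y| <= `|x0| -> 0 < cfun t y.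
Proof.
move: t; apply: (cfun_sfun_elim (P := fun c s t => 0 < t \/ eta ^+ 2 + t < 0 ->
  exists2 x0, t * s x0 = eta * c x0 & forall y, `|y| <= `|x0| -> 0 < c y)).
- move=> r r0 _; pose th := atan (eta / r).
  have th1 := atan_ltpi2 (eta / r); have th2 := atan_gtNpi2 (eta / r).
  have rth : r * (th / r) = th by rewrite mulrC divfK // gt_eqF.
  exists (th / r).
    have c0 : 0 < cos th by apply: cos_gt0_pihalf; rewrite th1 th2.
    rewrite rth; have := atanK (eta / r); rewrite -/th /tan => e.
    have -> : sin th = eta / r * cos th by rewrite -e divfK // gt_eqF.
    by field; rewrite gt_eqF.
  move=> y yx; apply: cos_gt0_pihalf; rewrite -ltr_norml normrM gtr0_norm //.
  apply: (@le_lt_trans _ _ (r * `|th / r|)); first by rewrite ler_wpM2l // ltW.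
  by rewrite -{1}(gtr0_norm r0) -normrM rth ltr_norml th1 th2.
- by move=> [|]; rewrite ?ltxx // addr0 ltNge sqr_ge0.
move=> r r0 [|er]; first by rewrite oppr_gt0 ltNge sqr_ge0.
have {}er : `|eta| < r.
  rewrite -(@ltr_pXn2r _ 2) ?nnegrE ?normr_ge0 ?(ltW r0) // real_normK ?num_real //; lra.
have /andP[e1 e2] : - r < eta < r by rewrite -ltr_norml.
(* The equation is tanh y = - eta / r, and [y] is the logarithmic form of its solution. *)
pose y := ln ((r - eta) / (r + eta)) / 2.
have q0 : 0 < (r - eta) / (r + eta) by rewrite divr_gt0 //; lra.
exists (y / r); last by move=> *; exact: cosh_gt0.
have -> : r * (y / r) = y by rewrite mulrC divfK // gt_eqF.
have ey : expR y * expR y = (r - eta) / (r + eta).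
  by rewrite -expRD /y -splitr lnK // posrE.
have {}ey : expR y * expR y * (r + eta) = r - eta.
  by rewrite ey divfK // gt_eqF //; lra.
have ey1 : expR y * expR (- y) = 1 by rewrite -expRD subrr expR0.
have := expR_gt0 y => ey0.
rewrite /sinh /cosh; apply/eqP; rewrite -subr_eq0; apply/eqP.
have -> : - r ^+ 2 * ((expR y - expR (- y)) / 2 / r) - eta * ((expR y + expR (- y)) / 2) =
  - (expR y * (r + eta) - expR (- y) * (r - eta)) / 2 by field; rewrite gt_eqF.
rewrite (_ : _ - _ = 0) ?oppr0 ?mul0r //.
by rewrite -ey !mulrA [expR (- y) * expR y]mulrC ey1 mul1r subrr.
Qed.

Section Translated.
Variables (t eta x0 : R).
Hypothesis hx0 : t * sfun t x0 = eta * cfun t x0.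

Lemma cfun_translate x : cfun t (x - x0) = cfun t x0 * (cfun t x + eta * sfun t x).
Proof.
by rewrite cfunB -mulrA [sfun t x * _]mulrC mulrA hx0; ring.
Qed.

Lemma sfun_translate x : t * sfun t (x - x0) = - (cfun t x0 * (- t * sfun t x + eta * cfun t x)).
Proof.
by rewrite sfunB mulrBr [t * (cfun t x * _)]mulrCA hx0; ring.
Qed.

(** The second hypothesis is positivity of [cfun t] on [- a - x0, a - x0]; since [cfun t] is even,
    the far end of this interval and its reflection cover everything beyond |x0|. *)
Lemma cfun_gt0_translate a : (forall y, `|y| <= `|x0| -> 0 < cfun t y) ->
  (forall x, - a <= x <= a -> 0 < cfun t x + eta * sfun t x) ->
  forall y, `|y| <= a + `|x0| -> 0 < cfun t y.
Proof.
move=> hc hu y hy; have [|yx] := leP `|y| `|x0|; first exact: hc.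
have c0 : 0 < cfun t x0 by exact: hc.
have hcN z : cfun t `|z| = cfun t z.
  by have [z0|z0] := leP 0 z; [rewrite ger0_norm|rewrite ltr0_norm // cfunN].
have main x : - a <= x <= a -> 0 < cfun t (x - x0).
  by move=> xa; rewrite cfun_translate mulr_gt0 // hu.
rewrite -hcN; have [x00|x00] := leP 0 x0.
  have -> : cfun t `|y| = cfun t (x0 - `|y| - x0) by rewrite -cfunN; congr cfun; ring.
  move: hy yx; rewrite (ger0_norm x00) => hy yx.
  by apply: main; apply/andP; split; lra.
have -> : cfun t `|y| = cfun t (`|y| + x0 - x0) by rewrite addrK.
move: hy yx; rewrite (ltr0_norm x00) => hy yx.
by apply: main; apply/andP; split; lra.
Qed.

End Translated.

Lemma sfun_ge0 t b x : (forall y, `|y| <= b -> 0 < cfun t y) -> 0 <= x <= b -> 0 <= sfun t x.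
Proof.
move=> hc /andP[x0 xb]; rewrite -(sfun0 t); apply: ge0_der_le (der_sfun t) x0 _.
by move=> z /andP[z0 zx]; apply/ltW/hc; rewrite gtr0_norm //; lra.
Qed.

(** For 0 <= Y <= Z, cross multiplication leaves s(Z) c(Y) - c(Z) s(Y) = s(Z - Y) >= 0. *)
Lemma tangent_mono t b y z : (forall y, `|y| <= b -> 0 < cfun t y) ->
  `|y| <= `|z| -> `|z| <= b -> (sfun t y / cfun t y) ^+ 2 <= (sfun t z / cfun t z) ^+ 2.
Proof.
move=> hc yz zb.
have hN x : (sfun t x / cfun t x) ^+ 2 = (sfun t `|x| / cfun t `|x|) ^+ 2.
  have [x0|x0] := leP 0 x; first by rewrite ger0_norm.
  by rewrite ltr0_norm // sfunN cfunN mulNr sqrrN.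
rewrite hN (hN z); have y0 := normr_ge0 y; set Y := `|y| in yz y0 *.
have z0 := normr_ge0 z; set Z := `|z| in yz zb z0 *.
have cY : 0 < cfun t Y by apply: hc; rewrite ger0_norm //; lra.
have cZ : 0 < cfun t Z by apply: hc; rewrite ger0_norm //; lra.
have sY : 0 <= sfun t Y by apply: (@sfun_ge0 _ b) => //; apply/andP; split; lra.
have sZ : 0 <= sfun t Z by apply: (@sfun_ge0 _ b) => //; apply/andP; split; lra.
have sZY : 0 <= sfun t (Z - Y) by apply: (@sfun_ge0 _ b) => //; apply/andP; split; lra.
have h : sfun t Y / cfun t Y <= sfun t Z / cfun t Z.
  rewrite ler_pdivrMr // mulrAC ler_pdivlMr // -subr_ge0.
  by move: sZY; rewrite sfunB; lra.
have hY : 0 <= sfun t Y / cfun t Y by rewrite divr_ge0 // ltW.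
by rewrite !expr2 ler_pM.
Qed.

End ModelFunctions.

(** * Logarithmic derivatives of the densities, and domination *)

Section Drift.
Context {R : realType}.
Implicit Types (K D h d n C r x : R) (N : \bar R) (k q : R -> R).

(** Quotients by [Jbase] or [cfun] are controlled only on an interval where the divisor is positive.
    Composing with the projection to that interval makes them continuous on the line. *)
Definition clamp (a x : R) : R := Num.max (- a) (Num.min a x).

Lemma cont_clamp a : continuous (clamp a).
Proof. by rewrite /clamp; cont. Qed.

Lemma clamp_id a x : - a <= x <= a -> clamp a x = x.
Proof. by move=> /andP[x1 x2]; rewrite /clamp min_r // max_r. Qed.

Lemma clamp_itv a x : 0 <= a -> - a <= clamp a x <= a.
Proof.
move=> a0; rewrite /clamp le_max lexx /= ge_max ge_min lexx andbT.
by have := a0; lra.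
Qed.

Lemma clamp_near a x : - a < x < a -> \forall y \near x, clamp a y = y.
Proof.
move=> /andP[x1 x2].
have r0 : 0 < Num.min (x + a) (a - x) by rewrite lt_min; apply/andP; split; lra.
near=> y; apply: clamp_id.
have : `|x - y| < Num.min (x + a) (a - x) by near: y; exact: (nbhsx_ballx x _ r0).
by rewrite lt_min !ltr_norml => /andP[/andP[? ?] /andP[? ?]]; apply/andP; split; lra.
Unshelve. all: by end_near. Qed.

(* [k] is the logarithmic derivative of [J]; after conjugation by the square root
   of [J], the associated Schroedinger potential is [K / 2 + C * k ^+ 2]. *)
Definition is_drift K N h d k C :=
  [/\ continuous k,
      exists Q A, [/\ der Q k, 0 < A &
        forall x, - (d / 2) <= x <= d / 2 -> J K N h x = A * expR (Q x)] &
      forall x, - (d / 2) < x < d / 2 ->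
        is_derive x (1 : R) k (- K + (2^-1 - 2 * C) * k x ^+ 2)].

Lemma drift_lambda K N h d k C r : 0 < d -> is_drift K N h d k C ->
  ((lambda K N h d < r%:E)%E -> negative (fun x => K / 2 + C * k x ^+ 2 - r) (d / 2)) /\
  (negative (fun x => K / 2 + C * k x ^+ 2 - r) (d / 2) -> (lambda K N h d <= r%:E)%E).
Proof.
move=> d0 [ck [Q [A [dQ A0 JE]]] dk].
have cV : continuous (fun x => K / 2 + C * k x ^+ 2) by cont.
have dk' x : - (d / 2) < x < d / 2 ->
    is_derive x (1 : R) k (k x ^+ 2 / 2 - 2 * (K / 2 + C * k x ^+ 2)).
  by move=> /dk; move/is_derive_eq; apply; field.
by split; [exact: (lambda_lt_negative d0 ck dQ A0 JE cV dk')
          |exact: (negative_lambda_le d0 ck dQ A0 JE cV dk')].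
Qed.

(** Here k' = - K has no quadratic term, so 1/2 - 2 C = 0. *)
Lemma drift_infinity K h d : 0 < d -> is_drift K +oo h d (fun x => h - K * x) (1 / 4).
Proof.
move=> d0; split; first by cont.
  exists (fun x => h * x - K * x ^+ 2 / 2), 1; split => //; last by move=> x _; rewrite mul1r.
  have dx2 : der (fun x : R => x ^+ 2) (fun x => 2 * x).
    by apply: der_eq (derM der_id der_id) _ => x; ring.
  have := derB (derM (der_cst h) der_id) (derM (derM (der_cst K) dx2) (der_cst 2^-1)).
  by move/der_eq; apply => x; field.
move=> x _; have := derB (der_cst h) (derM (der_cst K) der_id) x.
by move/is_derive_eq; apply; field.
Qed.

Definition Jbase' K n h x := - (delta K n%:E) * sfun (delta K n%:E) x
  + h / (n - 1) * cfun (delta K n%:E) x.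

Definition drift K n h x := (n - 1) * (Jbase' K n h x / Jbase K n h x).

Lemma der_Jbase K n h : der (Jbase K n h) (Jbase' K n h).
Proof.
apply: der_eq (derD (der_cfun _) (derM (der_cst (h / (n - 1))) (der_sfun _))) _.
by move=> x; rewrite mul0r add0r.
Qed.

Lemma der_Jbase' K n h : der (Jbase' K n h) (fun x => - delta K n%:E * Jbase K n h x).
Proof.
have := derD (derM (der_cst (- delta K n%:E)) (der_sfun (delta K n%:E)))
  (derM (der_cst (h / (n - 1))) (der_cfun (delta K n%:E))).
by move/der_eq; apply => x; rewrite /Jbase; ring.
Qed.

(** From u'' = - delta u, the drift k = (n - 1) u' / u satisfies k' = - K - k^2 / (n - 1), and C
    solves 1/2 - 2 C = - 1 / (n - 1). *)
Lemma drift_finite K n h d : n != 1 -> 0 < d ->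
  (forall x, - (d / 2) <= x <= d / 2 -> 0 < Jbase K n h x) ->
  is_drift K n%:E h d (fun x => drift K n h (clamp (d / 2) x)) ((n + 1) / (4 * (n - 1))).
Proof.
move=> n1 d0 u0; have a0 : 0 < d / 2 by rewrite divr_gt0.
set a := d / 2 in u0 a0 *; pose c := clamp a; pose u := Jbase K n h; pose w := Jbase' K n h.
have m0 : n - 1 != 0 by rewrite subr_eq0.
have uc0 x : 0 < u (c x) by apply: u0; exact: clamp_itv (ltW a0).
have cc : continuous c by exact: cont_clamp.
have cu : continuous u := der_continuous (@der_Jbase K n h).
have cw : continuous w := der_continuous (@der_Jbase' K n h).
have cuc : continuous (fun x => u (c x)) by cont.
have ck : continuous (fun x => drift K n h (c x)).
  have cv : continuous (fun x => (u (c x))^-1) by apply: contV => // x; rewrite gt_eqF.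
  have cwc : continuous (fun x => w (c x)) by cont.
  exact: contM (cont_cst (n - 1)) (contM cwc cv).
have cn x : - a < x < a -> \forall y \near x, y = c y.
  by move=> /clamp_near; apply: filterS => y e; exact: esym e.
have cin x : - a < x < a -> c x = x.
  by move=> /andP[x1 x2]; apply: clamp_id; rewrite !ltW.
split; first exact: ck.
  pose Q := prim (fun x => drift K n h (c x)); have dQ := primP ck.
  pose L x := (n - 1) * ln (u (c x)).
  have cL : continuous L.
    move=> x; apply: cvgM; first exact: cvg_cst.
    by apply: continuous_comp; [exact: cuc|exact: continuous_ln].
  have dL x : - a < x < a -> is_derive x (1 : R) L (drift K n h (c x)).
    move=> xa.
    apply: (@near_eq_is_derive _ _ _ (fun y => (n - 1) * ln (u y))).
      by have := cn x xa; apply: filterS => y e; rewrite /L -e.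
    have ux : 0 < u x by rewrite -(cin x xa).
    have D := is_derive_mul (der_cst (n - 1) x)
      (is_derive1_comp (is_derive1_ln ux) (@der_Jbase K n h x)).
    by apply: is_derive_eq D _; rewrite cin // /drift mul0r add0r -/u [_^-1 * _]mulrC.
  (* On the interval log J = [L] has the same derivative as [Q]; the constant between them is read
     off at - a. *)
  exists Q, (expR (L (- a) - Q (- a))); split => //; first exact: expR_gt0.
  move=> x xa; have /andP[x1 x2] := xa.
  have e : L x - L (- a) = Q x - Q (- a).
    have dLx z : - a < z < x -> is_derive z (1 : R) L (drift K n h (c z)).
      by move=> /andP[z1 z2]; apply: dL; rewrite z1 (lt_le_trans z2).
    by rewrite -(intgE _ _ dQ ck) (intgE_oo x1 ck cL dLx).
  have e3 : L (- a) - Q (- a) + Q x = L x.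
    by rewrite -addrA [- _ + _]addrC -e addrC subrK.
  rewrite -expRD e3.
  rewrite /L /J /powR -/(u x) (_ : c x = x); last exact: clamp_id.
  by rewrite gt_eqF // u0.
move=> x xa.
apply: (@near_eq_is_derive _ _ _ (drift K n h)).
  by have := cn x xa; apply: filterS => y e; congr (drift K n h).
have ex : clamp a x = x := cin x xa; rewrite ex.
have ux : 0 < u x by rewrite -(cin x xa).
have ux0 : u x != 0 by rewrite gt_eqF.
have dv : is_derive x (1 : R) (fun y => (u y)^-1) (- u x ^- 2 * w x).
  exact: is_deriveV ux0 (@der_Jbase K n h x).
have D := is_derive_mul (der_cst (n - 1) x) (is_derive_mul (@der_Jbase' K n h x) dv).
apply: is_derive_eq D _; rewrite /drift -/(u x) -/(w x) /delta.
by field; rewrite ux0 m0.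
Qed.

Lemma Dreg_Jbase K n h d D : Dreg K n%:E D (h, d) ->
  0 < d /\ forall x, - (d / 2) <= x <= d / 2 -> 0 < Jbase K n h x.
Proof.
move=> [/= d0 _ dU]; split=> // x xd.
have /dU [I [_ _ _ Ipos] Ix] : (`[- (d / 2), d / 2]%classic : set R) x by rewrite /= in_itv.
exact: Ipos.
Qed.

(** An arbitrary e > 0 absorbs the gap between strict and weak inequality. The value -oo is treated
    directly, without showing that the infimum is nonnegative. *)
Lemma lambda_le_of_lt (K1 K2 h1 h2 d1 d2 : R) (N1 N2 : \bar R) :
  (forall r, (lambda K2 N2 h2 d2 < r%:E)%E -> (lambda K1 N1 h1 d1 <= r%:E)%E) ->
  (lambda K1 N1 h1 d1 <= lambda K2 N2 h2 d2)%E.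
Proof.
move: (lambda K1 N1 h1 d1) (lambda K2 N2 h2 d2) => l1 [s| |] H.
- by apply/lee_addgt0Pr => e e0; rewrite -EFinD; apply: H; rewrite lte_fin ltrDl.
- exact: leey.
- case: l1 H => [x| |] H //.
    have : x <= x - 1 by rewrite -lee_fin; exact: H (ltNyr _).
    by move=> hx; exfalso; lra.
  by have := H 0 (ltNyr _).
Qed.

Lemma lambda_width K N h d1 d2 k1 k2 C : 0 < d1 -> d1 <= d2 ->
  is_drift K N h d1 k1 C -> is_drift K N h d2 k2 C ->
  (forall x, - (d1 / 2) < x < d1 / 2 -> k1 x = k2 x) ->
  (lambda K N h d2 <= lambda K N h d1)%E.
Proof.
move=> d10 d12 D1 D2 k12; have d20 : 0 < d2 by lra.
apply: lambda_le_of_lt => r /(drift_lambda r d10 D1).1 n1.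
apply: (drift_lambda r d20 D2).2.
have [ck1 _ _] := D1; have [ck2 _ _] := D2.
apply: (@negative_widen _ _ (d1 / 2)); [by cont|lra|lra|].
apply: (eq_negative _ _ _ _ n1); [lra|by cont|by cont|].
by move=> x /k12 ->.
Qed.

(* The lowest Dirichlet eigenvalue on [-a, a] for the potential [C * q1] is at most
   the one for [C * q2] if [0 <= C], and at least it if [C <= 0]; the constant [b]
   stands for minus a level to which the eigenvalues are compared. *)
Definition dominated a (q1 q2 : R -> R) := forall b C : R,
  (0 <= C -> negative (fun x => b + C * q2 x) a -> negative (fun x => b + C * q1 x) a) /\
  (C <= 0 -> negative (fun x => b + C * q1 x) a -> negative (fun x => b + C * q2 x) a).

Lemma dominated_le a q1 q2 : 0 < a -> continuous q1 -> continuous q2 ->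
  (forall x, - a < x < a -> q1 x <= q2 x) -> dominated a q1 q2.
Proof.
move=> a0 c1 c2 q12 b C; split=> C0 n0; apply: (eq_negative _ _ _ _ n0) => //; try by cont.
  by move=> x /q12 h; rewrite lerD2l ler_wpM2l.
by move=> x /q12 h; rewrite lerD2l ler_wnM2l.
Qed.

Lemma dominated_translate a (G : R -> R) t1 t2 : 0 < a -> continuous G ->
  (forall y z, `|y| <= `|z| -> G y <= G z) -> `|t1| <= `|t2| ->
  dominated a (fun x => G (x + t1)) (fun x => G (x + t2)).
Proof.
move=> a0 cG Gmono t12 b C; have cW : continuous (fun y => b + C * G y) by cont.
split=> C0.
  apply: (negative_translate_incr cW) => // y z yz.
  by rewrite lerD2l ler_wpM2l // Gmono.
apply: (negative_translate_decr cW) => // y z yz.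
by rewrite lerD2l ler_wnM2l // Gmono.
Qed.

Lemma dominated_opp a (q : R -> R) : 0 < a -> continuous q ->
  dominated a q (fun x => q (- x)) /\ dominated a (fun x => q (- x)) q.
Proof.
move=> a0 cq; have H b C : negative (fun x => b + C * q x) a -> negative (fun x => b + C * q (- x)) a.
  by move=> n0; apply: (negative_opp a0 _ n0); cont.
have H' b C : negative (fun x => b + C * q (- x)) a -> negative (fun x => b + C * q x) a.
  move=> n0; have c : continuous (fun x => b + C * q (- x)) by cont.
  by have := negative_opp a0 c n0; under eq_fun do rewrite opprK.
by split=> b C; split=> _; [exact: H'|exact: H|exact: H|exact: H'].
Qed.

Lemma dominated_trans a q1 q2 q3 : dominated a q1 q2 -> dominated a q2 q3 -> dominated a q1 q3.
Proof.
move=> h12 h23 b C; have [h1 h1'] := h12 b C; have [h2 h2'] := h23 b C.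
by split=> C0 n0; [apply: h1 => //; exact: h2|apply: h2' => //; exact: h1'].
Qed.

Lemma lambda_dominated K N d h1 h2 k1 k2 C : 0 < d ->
  is_drift K N h1 d k1 C -> is_drift K N h2 d k2 C ->
  dominated (d / 2) (fun x => k1 x ^+ 2) (fun x => k2 x ^+ 2) ->
  (0 <= C -> (lambda K N h1 d <= lambda K N h2 d)%E) /\
  (C <= 0 -> (lambda K N h2 d <= lambda K N h1 d)%E).
Proof.
move=> d0 D1 D2 dom.
have Hk r k : (fun x => K / 2 + C * k x ^+ 2 - r) = (fun x => (K / 2 - r) + C * k x ^+ 2).
  by apply/funext => x; ring.
split=> C0; apply: lambda_le_of_lt => r.
  move=> /(drift_lambda r d0 D2).1; rewrite Hk => n0; apply: (drift_lambda r d0 D1).2.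
  by rewrite Hk; apply: (dom _ _).1 n0.
move=> /(drift_lambda r d0 D1).1; rewrite Hk => n0; apply: (drift_lambda r d0 D2).2.
by rewrite Hk; apply: (dom _ _).2 n0.
Qed.

Lemma dominated_infinity K d h1 h2 : 0 < d -> `|h1| <= `|h2| ->
  dominated (d / 2) (fun x => (h1 - K * x) ^+ 2) (fun x => (h2 - K * x) ^+ 2).
Proof.
move=> d0 h12; have a0 : 0 < d / 2 by rewrite divr_gt0.
(* For K = 0 the drift is the constant h and has no centre h / K. *)
have [->|K0] := eqVneq K 0.
  apply: dominated_le => //; [by cont|by cont|move=> x _].
  by rewrite !mul0r !subr0 -[leLHS]real_normK ?num_real // -[leRHS]real_normK ?num_real // lerXn2r ?nnegrE.
pose G y := K ^+ 2 * y ^+ 2.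
have cG : continuous G by rewrite /G; cont.
have -> : (fun x => (h1 - K * x) ^+ 2) = (fun x => G (x + - (h1 / K))).
  by apply/funext => x; rewrite /G; field.
have -> : (fun x => (h2 - K * x) ^+ 2) = (fun x => G (x + - (h2 / K))).
  by apply/funext => x; rewrite /G; field.
apply: dominated_translate => //.
  move=> y z yz; rewrite /G ler_wpM2l ?sqr_ge0 //.
  by rewrite -[leLHS]real_normK ?num_real // -[leRHS]real_normK ?num_real // lerXn2r ?nnegrE.
by rewrite !normrN !normrM ler_wpM2r.
Qed.

End Drift.

(** * Dependence on h for finite N *)

Section Comparison.
Context {R : realType}.
Implicit Types (K D h d n C r x t : R) (N : \bar R) (k q : R -> R).

Lemma clampN (a x : R) : 0 <= a -> clamp a (- x) = - clamp a x.
Proof.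
move=> a0; rewrite /clamp; have [xa|xa] := leP x (- a).
  rewrite (min_r (_ : x <= a)); last lra.
  by rewrite (max_l xa) opprK min_l ?max_r; lra.
have [xa'|xa'] := leP a x.
  by rewrite (max_r (_ : - a <= a)) ?min_r ?max_l //; lra.
by rewrite (max_r (_ : - a <= x)) ?min_r ?max_r //; lra.
Qed.

Lemma norm_clamp (a x : R) : 0 <= a -> `|clamp a x| = Num.min `|x| a.
Proof.
move=> a0; wlog x0 : x / 0 <= x => [H|].
  have [x0|x0] := leP 0 x; first exact: H.
  by rewrite -normrN -clampN // -(normrN x); apply: H; lra.
have m0 : 0 <= Num.min a x by rewrite le_min a0 x0.
have -> : clamp a x = Num.min a x by rewrite /clamp max_r //; lra.
by rewrite !ger0_norm // minC.
Qed.

Lemma dominated_refl a q1 q2 : 0 < a -> continuous q1 -> continuous q2 ->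
  (forall x, - a < x < a -> q1 x = q2 x) -> dominated a q1 q2.
Proof. by move=> a0 c1 c2 e; apply: dominated_le => // x /e ->. Qed.

Lemma cont_drift_clamp K n h a : 0 < a -> n != 1 ->
  (forall x, - a <= x <= a -> 0 < Jbase K n h x) ->
  continuous (fun x => drift K n h (clamp a x)).
Proof.
move=> a0 n1 u0.
have d0 : 0 < 2 * a by lra.
have e : 2 * a / 2 = a by field.
have := @drift_finite _ K n h _ n1 d0; rewrite e => /(_ u0) [] ck _ _; exact: ck.
Qed.

(** Both squared drifts are translates of one even function [G], a multiple of the squared tangent s
    / c, which increases with |x|. The condition on [h2] passes to [h1], whose slope has the smaller
    square. *)
Lemma dominated_center K n h1 h2 a : 0 < a -> n != 1 ->
  let t := delta K n%:E in let eta h := h / (n - 1) in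
  0 < t \/ eta h2 ^+ 2 + t < 0 -> eta h1 ^+ 2 < eta h2 ^+ 2 ->
  (forall x, - a <= x <= a -> 0 < Jbase K n h1 x) ->
  (forall x, - a <= x <= a -> 0 < Jbase K n h2 x) ->
  dominated a (fun x => drift K n h1 (clamp a x) ^+ 2) (fun x => drift K n h2 (clamp a x) ^+ 2).
Proof.
move=> a0 n1 t eta ht h12 u1 u2.
have cd1 : continuous (fun x => drift K n h1 (clamp a x)) by exact: cont_drift_clamp.
have cd2 : continuous (fun x => drift K n h2 (clamp a x)) by exact: cont_drift_clamp.
have ht1 : 0 < t \/ eta h1 ^+ 2 + t < 0 by case: ht; [left|right; lra].
have m0 : n - 1 != 0 by rewrite subr_eq0.
have [x1 e1 p1] := center_exists ht1; have [x2 e2 p2] := center_exists ht.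
(* A radius containing all x - x1 and x - x2 for |x| <= a, on which [cfun t] is positive. *)
pose B := a + Num.max `|x1| `|x2|.
have B0 : 0 <= B by rewrite addr_ge0 ?(ltW a0) // le_max normr_ge0.
have hB y : `|y| <= B -> 0 < cfun t y.
  rewrite /B; have [x12|x12] := leP `|x1| `|x2|.
    exact: (cfun_gt0_translate e2 p2 u2).
  exact: (cfun_gt0_translate e1 p1 u1).
have hcB y : 0 < cfun t (clamp B y) by apply: hB; rewrite norm_clamp // ge_min lexx orbT.
pose G y := ((n - 1) * t) ^+ 2 * (sfun t (clamp B y) / cfun t (clamp B y)) ^+ 2.
have cG : continuous G.
  have cB : continuous (clamp B) by exact: cont_clamp.
  have c1 : continuous (cfun t) by exact: der_continuous (der_cfun t).
  have c2 : continuous (sfun t) by exact: der_continuous (der_sfun t).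
  have c3 : continuous (fun y => cfun t (clamp B y)) by cont.
  have c4 : continuous (fun y => (cfun t (clamp B y))^-1).
    by apply: contV => // y; rewrite gt_eqF.
  by rewrite /G; cont.
have Gmono y z : `|y| <= `|z| -> G y <= G z.
  move=> yz; rewrite /G ler_wpM2l ?sqr_ge0 //; apply: (tangent_mono hB).
    rewrite !norm_clamp // le_min !ge_min lexx orbT andbT yz //.
  by rewrite norm_clamp // ge_min lexx orbT.
have tan0 h x0 : `|x0| <= B -> t * sfun t x0 = eta h * cfun t x0 ->
    t ^+ 2 * (sfun t x0 / cfun t x0) ^+ 2 = eta h ^+ 2.
  move=> /hB c0 e; rewrite -exprMn mulrA e mulfK // gt_eqF //.
(* At the centres the squared tangent is eta^2 / t^2, so the order of the slopes is that of the
   centres. *)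
have x12 : `|x1| <= `|x2|.
  rewrite leNgt; apply/negP => x21.
  have b1 : `|x1| <= B by rewrite /B; apply: (@le_trans _ _ (Num.max `|x1| `|x2|)); [rewrite le_max lexx|lra].
  have b2 : `|x2| <= B by apply: le_trans b1; exact: ltW.
  have := tangent_mono hB (ltW x21) b1.
  have := tan0 _ _ b1 e1; have := tan0 _ _ b2 e2 => E2 E1 le12.
  have := ler_wpM2l (sqr_ge0 t) le12; rewrite E1 E2; lra.
have GE h x0 x : - a <= x <= a -> `|x0| <= Num.max `|x1| `|x2| ->
    t * sfun t x0 = eta h * cfun t x0 -> 0 < Jbase K n h x ->
    drift K n h (clamp a x) ^+ 2 = G (x - x0).
  move=> xa x0m e ux; rewrite clamp_id //.
  have xB : `|x - x0| <= B.
    apply: le_trans (ler_normB _ _) _; rewrite /B lerD // ler_norml.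
    by move: xa => /andP[-> ->].
  rewrite /G clamp_id; last by rewrite -ler_norml.
  have cpos := hB _ xB; have c0 : 0 < cfun t x0.
    by apply: hB; apply: le_trans x0m _; rewrite /B; lra.
  have f1 := cfun_translate e x; have f2 := sfun_translate e x.
  rewrite -exprMn -mulrA [t * (_ / _)]mulrA f2 f1 /drift.
  rewrite -/(Jbase K n h x) -/(Jbase' K n h x).
  rewrite -[in RHS]mulNr -mulf_div mulNr divff ?gt_eqF // mulN1r mulrN sqrrN //.
have m1 : `|x1| <= Num.max `|x1| `|x2| by rewrite le_max lexx.
have m2 : `|x2| <= Num.max `|x1| `|x2| by rewrite le_max lexx orbT.
have inI x : - a < x < a -> - a <= x <= a by move=> /andP[? ?]; rewrite !ltW.
apply: (@dominated_trans _ _ _ (fun x => G (x + - x1))).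
  apply: dominated_refl => //; [by cont|by cont|].
  by move=> x /inI xa; exact: (GE _ _ _ xa m1 e1 (u1 _ xa)).
apply: (@dominated_trans _ _ _ (fun x => G (x + - x2))).
  by apply: dominated_translate => //; rewrite !normrN.
apply: dominated_refl => //; [by cont|by cont|].
by move=> x /inI xa; apply/esym; exact: (GE _ _ _ xa m2 e2 (u2 _ xa)).
Qed.

(** With u = c + e s and w = - t s + e c, the identity [W] reads (w / u)^2 = - t + (e^2 + t) / u^2.
    If e1^2 + t < 0, the two squares are separated by - t; otherwise both w are nonnegative and w /
    u increases with e. *)
Lemma slope_le (c s t e1 e2 : R) : t <= 0 -> 0 < c -> c ^+ 2 + t * s ^+ 2 = 1 ->
  0 <= e1 <= e2 -> 0 <= e2 ^+ 2 + t -> 0 < c + e1 * s -> 0 < c + e2 * s ->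
  ((- t * s + e1 * c) / (c + e1 * s)) ^+ 2 <= ((- t * s + e2 * c) / (c + e2 * s)) ^+ 2.
Proof.
move=> t0 c0 ct /andP[e10 e12] e2t u1 u2.
have W e : (- t * s + e * c) ^+ 2 = e ^+ 2 + t - t * (c + e * s) ^+ 2.
  rewrite (_ : e ^+ 2 + t = (e ^+ 2 + t) * (c ^+ 2 + t * s ^+ 2)); first by ring.
  by rewrite ct mulr1.
have [e1t|e1t] := leP 0 (e1 ^+ 2 + t).
  have w0 e : 0 <= e -> 0 <= e ^+ 2 + t -> 0 <= - t * s + e * c.
    move=> e0 et; rewrite addrC -lerBlDr sub0r mulNr opprK.
    have [ts|ts] := leP (t * s) 0; first by apply: le_trans ts _; rewrite mulr_ge0 // ltW.
    have ec : 0 <= e * c by rewrite mulr_ge0 // ltW.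
    rewrite -(@ler_pXn2r _ 2) ?nnegrE // ?(ltW ts) // -subr_ge0.
    rewrite (_ : _ - _ = (e ^+ 2 + t) * c ^+ 2 - t * (c ^+ 2 + t * s ^+ 2)); last by ring.
    by rewrite ct mulr1 addr_ge0 ?oppr_ge0 // mulr_ge0 ?sqr_ge0.
  have w1 := w0 _ e10 e1t; have w2 := w0 _ (le_trans e10 e12) e2t.
  have h : (- t * s + e1 * c) / (c + e1 * s) <= (- t * s + e2 * c) / (c + e2 * s).
    rewrite ler_pdivrMr // mulrAC ler_pdivlMr // -subr_ge0.
    rewrite (_ : _ - _ = (e2 - e1) * (c ^+ 2 + t * s ^+ 2)); last by ring.
    by rewrite ct mulr1 subr_ge0.
  have q1 : 0 <= (- t * s + e1 * c) / (c + e1 * s) by rewrite divr_ge0 // ltW.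
  by rewrite !expr2 ler_pM.
apply: (@le_trans _ _ (- t)); rewrite expr_div_n.
  by rewrite ler_pdivrMr ?exprn_gt0 // W; lra.
by rewrite ler_pdivlMr ?exprn_gt0 // W; lra.
Qed.

Lemma dominated_nonneg K n h1 h2 a : 0 < a -> n != 1 -> 0 <= h1 -> h1 <= h2 ->
  (forall x, - a <= x <= a -> 0 < Jbase K n h1 x) ->
  (forall x, - a <= x <= a -> 0 < Jbase K n h2 x) ->
  dominated a (fun x => drift K n h1 (clamp a x) ^+ 2) (fun x => drift K n h2 (clamp a x) ^+ 2).
Proof.
move=> a0 n1 h10 h12 u1 u2.
have cd1 : continuous (fun x => drift K n h1 (clamp a x)) by exact: cont_drift_clamp.
have cd2 : continuous (fun x => drift K n h2 (clamp a x)) by exact: cont_drift_clamp.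
have [->|h12'] := eqVneq h1 h2.
  by apply: dominated_refl => //; cont.
have {}h12' : h1 < h2 by rewrite lt_neqAle h12'.
have m0 : n - 1 != 0 by rewrite subr_eq0.
have hh : (h1 / (n - 1)) ^+ 2 < (h2 / (n - 1)) ^+ 2.
  rewrite !expr_div_n ltr_pM2r ?invr_gt0 ?exprn_even_gt0 //.
  by rewrite ltr_pXn2r ?nnegrE //; lra.
set t := delta K n%:E.
(* Since eta1^2 < eta2^2, both slopes have a centre as soon as the larger one does. In the remaining
   case the comparison is pointwise, even if the smaller slope alone has a centre. *)
have [t0|t0] := ltP 0 t; first by apply: dominated_center => //; left.
have [e2t|e2t] := ltP ((h2 / (n - 1)) ^+ 2 + t) 0; first by apply: dominated_center => //; right.
apply: dominated_le => //; [by cont|by cont|].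
move=> x /andP[x1 x2].
have xa : - a <= x <= a by rewrite !ltW.
rewrite clamp_id // /drift [leLHS]exprMn [leRHS]exprMn ler_wpM2l ?sqr_ge0 //.
have := u1 _ xa; have := u2 _ xa; rewrite /Jbase /Jbase' -/t => U2 U1.
have [m_pos|m_neg] := ltP 0 (n - 1).
  apply: slope_le => //; [exact: cfun_gt0|exact: cfun2_sfun2|].
  by rewrite divr_ge0 ?(ltW m_pos) //= ler_pM2r // invr_gt0.
have {}m_neg : n - 1 < 0 by rewrite lt_neqAle m0.
(* For n < 1 the slopes h / (n - 1) are nonpositive; changing the signs of the slope and of s
   together only changes the sign of the quotient. *)
have E e : ((- t * sfun t x + e * cfun t x) / (cfun t x + e * sfun t x)) ^+ 2 =
    ((- t * - sfun t x + - e * cfun t x) / (cfun t x + - e * - sfun t x)) ^+ 2.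
  rewrite (_ : - t * - sfun t x + - e * cfun t x = - (- t * sfun t x + e * cfun t x)).
    by rewrite mulrNN mulNr sqrrN.
  by ring.
rewrite (E (h1 / _)) (E (h2 / _)).
apply: slope_le; rewrite ?mulrNN ?sqrrN ?cfun2_sfun2 ?cfun_gt0 //.
rewrite oppr_ge0 lerN2; apply/andP; split.
  by rewrite mulr_ge0_le0 // invr_le0 ltW.
by rewrite ler_nM2r // invr_lt0.
Qed.

Lemma JbaseN K n h x : Jbase K n (- h) x = Jbase K n h (- x).
Proof. by rewrite /Jbase cfunN sfunN mulNr mulNr mulrN. Qed.

Lemma driftN K n h x : drift K n (- h) x = - drift K n h (- x).
Proof.
rewrite /drift JbaseN -mulrN -mulNr; congr (_ * (_ / _)).
by rewrite /Jbase' cfunN sfunN; ring.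
Qed.

(** Changing the sign of h reflects the density, and reflection preserves the Dirichlet levels. *)
Lemma dominated_abs K n h a : 0 < a -> n != 1 ->
  (forall x, - a <= x <= a -> 0 < Jbase K n h x) ->
  [/\ forall x, - a <= x <= a -> 0 < Jbase K n `|h| x,
     dominated a (fun x => drift K n h (clamp a x) ^+ 2) (fun x => drift K n `|h| (clamp a x) ^+ 2) &
     dominated a (fun x => drift K n `|h| (clamp a x) ^+ 2) (fun x => drift K n h (clamp a x) ^+ 2)].
Proof.
move=> a0 n1 u0.
have cd : continuous (fun x => drift K n h (clamp a x)) by exact: cont_drift_clamp.
have [h0|h0] := leP 0 h.
  by rewrite ger0_norm //; split => //; apply: dominated_refl => //; cont.
have e : (fun x => drift K n `|h| (clamp a x) ^+ 2) =
    (fun x => (fun y => drift K n h (clamp a y) ^+ 2) (- x)).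
  by apply/funext => x; rewrite ltr0_norm // driftN sqrrN clampN // ltW.
have cq : continuous (fun x => drift K n h (clamp a x) ^+ 2) by cont.
rewrite e; split; [|exact: (dominated_opp a0 cq).1|exact: (dominated_opp a0 cq).2].
move=> x /andP[x1 x2]; rewrite ltr0_norm // JbaseN; apply: u0.
by apply/andP; split; lra.
Qed.

Lemma dominated_finite K n h1 h2 a : 0 < a -> n != 1 -> `|h1| <= `|h2| ->
  (forall x, - a <= x <= a -> 0 < Jbase K n h1 x) ->
  (forall x, - a <= x <= a -> 0 < Jbase K n h2 x) ->
  dominated a (fun x => drift K n h1 (clamp a x) ^+ 2) (fun x => drift K n h2 (clamp a x) ^+ 2).
Proof.
move=> a0 n1 h12 u1 u2.
have [v1 d1 _] := dominated_abs a0 n1 u1; have [v2 _ d2] := dominated_abs a0 n1 u2.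
apply: dominated_trans d1 (dominated_trans _ d2).
by apply: dominated_nonneg.
Qed.

End Comparison.

Theorem theorem5p1p3 (R : realType) (K : R) (N : \bar R) (D : R)
  (hN : ((-oo < N)%E /\ (N <= 0)%E) \/ (1 < N)%E) (hD : 0 < D) :
  (forall h0 : R, (exists d, Dreg K N D (h0, d)) ->
     forall d1 d2 : R, Dreg K N D (h0, d1) -> Dreg K N D (h0, d2) ->
       d1 <= d2 -> (lambda K N h0 d2 <= lambda K N h0 d1)%E)
  /\
  (forall d0 : R, (exists h, Dreg K N D (h, d0)) ->
     [/\ ((-oo < N)%E /\ (N < (-1)%:E)%E) \/ (1 < N)%E ->
           forall h1 h2 : R, Dreg K N D (h1, d0) -> Dreg K N D (h2, d0) ->
             `|h1| <= `|h2| -> (lambda K N h1 d0 <= lambda K N h2 d0)%E,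
         ((-1)%:E < N)%E /\ (N <= 0)%E ->
           forall h1 h2 : R, Dreg K N D (h1, d0) -> Dreg K N D (h2, d0) ->
             `|h1| <= `|h2| -> (lambda K N h2 d0 <= lambda K N h1 d0)%E
       & N = (-1)%:E ->
           forall h1 h2 : R, Dreg K N D (h1, d0) -> Dreg K N D (h2, d0) ->
             lambda K N h1 d0 = lambda K N h2 d0]).
Proof.
case: N hN => [n| |] hN; last by case: hN => [[]|].
- have n1 : n != 1.
    case: hN => [[_]|]; rewrite ?lee_fin ?lte_fin => h; last by rewrite gt_eqF.
    by rewrite lt_eqF //; lra.
  split.
    move=> h0 _ d1 d2 /Dreg_Jbase [d10 u1] /Dreg_Jbase [d20 u2] d12.
    apply: (lambda_width d10 d12 (drift_finite n1 d10 u1) (drift_finite n1 d20 u2)).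
    move=> x /andP[x1 x2]; rewrite !clamp_id //; first by apply/andP; split; lra.
    by rewrite !ltW.
  move=> d0 _.
  (* The three regimes of N are the signs of C: positive for n < -1 or n > 1, zero at n = -1,
     negative for -1 < n <= 0. *)
  have key h1 h2 : Dreg K n%:E D (h1, d0) -> Dreg K n%:E D (h2, d0) -> `|h1| <= `|h2| ->
      (0 <= (n + 1) / (4 * (n - 1)) -> (lambda K n%:E h1 d0 <= lambda K n%:E h2 d0)%E) /\
      ((n + 1) / (4 * (n - 1)) <= 0 -> (lambda K n%:E h2 d0 <= lambda K n%:E h1 d0)%E).
    move=> /Dreg_Jbase [d00 u1] /Dreg_Jbase [_ u2] h12.
    apply: (lambda_dominated d00 (drift_finite n1 d00 u1) (drift_finite n1 d00 u2)).
    by apply: dominated_finite => //; rewrite divr_gt0.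
  split.
  + move=> hn h1 h2 D1 D2 h12; apply: (key _ _ D1 D2 h12).1.
    case: hn => [[_]|]; rewrite lte_fin => hn; last by rewrite divr_ge0 //; lra.
    by rewrite -mulrNN -invrN divr_ge0 //; lra.
  + move=> [hn hn0] h1 h2 D1 D2 h12; apply: (key _ _ D1 D2 h12).2.
    rewrite lte_fin in hn; rewrite lee_fin in hn0.
    by rewrite mulr_ge0_le0 // ?invr_le0; lra.
  + move=> [hn] h1 h2 D1 D2.
    have C0 : (n + 1) / (4 * (n - 1)) = 0 by rewrite hn addNr mul0r.
    rewrite C0 in key; apply/le_anti/andP.
    have [h12|/ltW h21] := leP `|h1| `|h2|.
      by have [k1 k2] := key _ _ D1 D2 h12; split; [exact: k1 (lexx 0)|exact: k2 (lexx 0)].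
    by have [k1 k2] := key _ _ D2 D1 h21; split; [exact: k2 (lexx 0)|exact: k1 (lexx 0)].
split.
  move=> h0 _ d1 d2 [/= d10 _ _] [/= d20 _ _] d12.
  by apply: (lambda_width d10 d12 (drift_infinity K h0 d10) (drift_infinity K h0 d20)).
move=> d0 _; split.
- move=> _ h1 h2 [/= d00 _ _] _ h12.
  apply: (lambda_dominated d00 (drift_infinity K h1 d00) (drift_infinity K h2 d00) _).1.
    exact: dominated_infinity.
  by rewrite divr_ge0.
- by move=> [_ hle]; exfalso; move: hle; rewrite leye_eq.
- by move=> e; exfalso; discriminate e.
Qed.
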